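(* Let $p$ be an odd prime, $\varepsilon$ a non-square modulo $p$, and $n$ a positive integer prime to $p$. The geometric and the algebraic definitions of the Hecke operator $\mathscr{T}_n^{\varepsilon}$ coincide. Explicitly, for every $\tau\in\mathcal{H}$, writing the algebraic Hecke operator $\mathscr{T}_n^{\varepsilon}=h(T_n)$ as a sum of left cosets $\sum_i\Gamma_{ns}^{\varepsilon}(p)\alpha_i$, one has the equality of divisors on $Y_{ns}^{\varepsilon}(p)$ $$\sum_i\big(E_{\alpha_i\tau},\phi_{\alpha_i\tau}\big)=\sum_{\psi:E_\tau\to E'}\Big(E',\tfrac1n\,\psi\circ\phi_\tau\circ\hat\psi\Big),$$ where the right-hand sum runs over the degree $n$ isogenies $\psi$ from $E_\tau$ with cyclic kernel (one for each cyclic subgroup of order $n$) and $\hat\psi$ is the dual isogeny.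
   Context: $\mathcal{H}$ is the Poincaré upper half-plane. $C_{ns}^{\varepsilon}(p)=\{\left(\begin{smallmatrix}a&b\\c&d\end{smallmatrix}\right)\in M_2(\mathbb{F}_p): a=d,\ c=\varepsilon b\}$; $M_{ns}^{\varepsilon}(p)$ is the set of integral $2\times2$ matrices whose reduction modulo $p$ lies in $C_{ns}^{\varepsilon}(p)$; $\Gamma_{ns}^{\varepsilon}(p)$ is the group of determinant $1$ matrices in $M_{ns}^{\varepsilon}(p)$; $Y_{ns}^{\varepsilon}(p)=\Gamma_{ns}^{\varepsilon}(p)\backslash\mathcal{H}$; $\Gamma(p)$ is the principal congruence subgroup of level $p$. Moduli interpretation: points of $Y_{ns}^{\varepsilon}(p)$ are identified with isomorphism classes of pairs $(E,\phi)$, $E/\mathbb{C}$ an elliptic curve and $\phi\in\mathrm{End}_{\mathbb{F}_p}(E[p])$ with $\phi^2$ equal to multiplication by $\varepsilon$, where $(E,\phi)\cong(E',\phi')$ if there is an isomorphism $\Psi:E\to E'$ with $\Psi\phi=\phi'\Psi$. The point $\Gamma_{ns}^{\varepsilon}(p)\tau$ corresponds to $(E_\tau,\phi_\tau)$, $E_\tau=\mathbb{C}/\langle\tau,1\rangle$, $\phi_\tau(\frac1p)=\frac{\varepsilon\tau}{p}$, $\phi_\tau(\frac\tau p)=\frac1p$. Geometric definition: for $n$ a positive integer prime to $p$, $\mathscr{T}_n^{\varepsilon}((E,\phi))=\sum_{\psi:E\to E'}(E',\frac1n\psi\circ\phi\circ\hat\psi)$, the sum being over degree $n$ isogenies with cyclic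 kernel; $\frac1n$ makes sense in $\mathrm{End}_{\mathbb{F}_p}(E'[p])$ since $p\nmid n$. Algebraic definition: let $\Delta_{ns}^{\varepsilon}(p)$ (resp. $\Delta(p)$) be the set of integral matrices with positive determinant prime to $p$ lying in $M_{ns}^{\varepsilon}(p)$ (resp. congruent to $\left(\begin{smallmatrix}1&0\\0&*\end{smallmatrix}\right)$ modulo $p$), and $R(\Gamma,\Delta)$ the Hecke ring of double cosets $\Gamma\alpha\Gamma$, $\alpha\in\Delta$. For $n$ prime to $p$ let $A_n^{\varepsilon}\in \mathrm{SL}_2(\mathbb{Z})$ be such that $A_n^{\varepsilon}\equiv B\left(\begin{smallmatrix}1&0\\0&1/n\end{smallmatrix}\right)\pmod p$ for some $B\in\Delta_{ns}^{\varepsilon}(p)$ with $\det B\equiv n\pmod p$. Let $h:R(\Gamma(p),\Delta(p))\to R(\Gamma_{ns}^{\varepsilon}(p),\Delta_{ns}^{\varepsilon}(p))$ be the linear map $\Gamma(p)\beta\Gamma(p)\mapsto\Gamma_{ns}^{\varepsilon}(p)A_{\det\beta}^{\varepsilon}\beta\,\Gamma_{ns}^{\varepsilon}(p)$. The operator $T_n\in R(\Gamma(p),\Delta(p))$ is the classical Hecke operator, i.e. the sum of all double cosets $\Gamma(p)\beta\Gamma(p)$ with $\beta\in\Delta(p)$, $\det\beta=n$, and the algebraic Hecke operator is $\mathscr{T}_n^{\varepsilon}=h(T_n)$. A double coset $\Gamma_{ns}^{\varepsilon}(p)\alpha\Gamma_{ns}^{\varepsilon}(p)=\bigsqcup_i\Gamma_{ns}^{\varepsilon}(p)\alpha_i$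 acts as the correspondence $\Gamma_{ns}^{\varepsilon}(p)\tau\mapsto\sum_i\Gamma_{ns}^{\varepsilon}(p)\alpha_i\tau$.
   Formalization: False for non-squarefree n (n=4, p=3: degrees 7 and 6). The formal theorem proves the stated equality for squarefree n, and for all n both: primitive α_i versus cyclic kernels, and all α_i versus all degree n isogenies. *)

(* Defs.v *)
From HB Require Import structures.
From mathcomp Require Import all_boot all_order all_algebra.
From mathcomp Require Import generic_quotient ring_quotient.
From mathcomp Require Import mathcomp_extra boolp classical_sets functions.
From mathcomp Require Import cardinality fsbigop reals topology normedtype derive.
From mathcomp Require Import complex freeg ring.
Import numFieldNormedType.Exports.

Set Implicit Arguments.
Unset Strict Implicit.
Unset Printing Implicit Defensive.

Import Order.TTheory GRing.Theory Num.Theory.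

Local Open Scope quotient_scope.
Local Open Scope classical_set_scope.
Local Open Scope complex_scope.
Local Open Scope ring_scope.

Section Torsion.
Variables (p : nat) (E : zmodType).

Definition torsion : {pred E} := [pred x | x *+ p == 0].

Fact torsion_zmod_closed : zmod_closed torsion.
Proof.
split=> [|x y]; rewrite !inE ?mul0rn // => /eqP hx /eqP hy.
by rewrite mulrnBl hx hy subrr.
Qed.

HB.instance Definition _ :=
  GRing.isZmodClosed.Build E torsion torsion_zmod_closed.

Record tors := Tors { tors_val : E; tors_valP : tors_val \in torsion }.

HB.instance Definition _ := [isSub for tors_val].
HB.instance Definition _ := [Choice of tors by <:].
HB.instance Definition _ := [SubChoice_isSubZmodule of tors by <:].

End Torsion.
Arguments torsion : clear implicits.

Section TorsionMap.
Variables (p : nat) (E E' : zmodType) (f : {additive E -> E'}).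

Fact tors_map_subproof (x : tors p E) : f (val x) \in torsion p E'.
Proof. by rewrite inE -raddfMn (eqP (valP x)) raddf0. Qed.

Definition tors_map (x : tors p E) : tors p E' := Tors (tors_map_subproof x).

Fact tors_map_is_additive : additive tors_map.
Proof. by move=> x y; apply: val_inj; rewrite /= raddfB. Qed.

HB.instance Definition _ :=
  GRing.isAdditive.Build (tors p E) (tors p E') tors_map tors_map_is_additive.

End TorsionMap.
Arguments tors_map p {E E'} f x.

Section Tori.
Variable R : realType.

(* The condition on [w1 / w2] says that [w1] and [w2] are linearly independent
   over the reals; it excludes [w2 = 0] because [w1 / 0 = 0]. *)
Definition is_lattice (L : set R[i]) :=
  exists w1 w2 : R[i], complex.Im (w1 / w2) != 0 /\
    L = [set z | exists a b : int, z = a%:~R * w1 + b%:~R * w2].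

Record lattice := Lattice { lattice_set : set R[i];
                            latticeP : is_lattice lattice_set }.

Definition in_lattice (L : lattice) : {pred R[i]} :=
  [pred z | `[< lattice_set L z >]].

Fact in_latticeP (L : lattice) (z : R[i]) :
  reflect (lattice_set L z) (z \in in_lattice L).
Proof. by rewrite unfold_in; apply: asboolP. Qed.

Fact in_lattice_zmod_closed (L : lattice) : zmod_closed (in_lattice L).
Proof.
have [w1 [w2 [_ LE]]] := latticeP L.
split=> [|x y].
  by apply/in_latticeP; rewrite LE /=; exists 0, 0; rewrite !mul0r addr0.
move=> /in_latticeP; rewrite {1}LE /= => -[a [b ->]].
move=> /in_latticeP; rewrite {1}LE /= => -[c [d ->]].
apply/in_latticeP; rewrite LE /=; exists (a - c), (b - d).
by rewrite !rmorphB /= !mulrBl opprD addrACA.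
Qed.

HB.instance Definition _ (L : lattice) :=
  GRing.isZmodClosed.Build R[i] (in_lattice L) (in_lattice_zmod_closed L).

Definition torus (L : lattice) : zmodType := Quotient.quot (in_lattice L).

Definition to_torus (L : lattice) (z : R[i]) : torus L :=
  \pi_(Quotient.quot (in_lattice L)) z.

Lemma to_torus_eq (L : lattice) (x y : R[i]) :
  to_torus L x = to_torus L y <-> lattice_set L (x - y).
Proof.
rewrite /to_torus; split=> [/eqP|h]; last apply/eqP.
  by rewrite -Quotient.idealrBE => /in_latticeP.
by rewrite -Quotient.idealrBE; apply/in_latticeP.
Qed.

Lemma to_torus_surj (L : lattice) (x : torus L) : exists z, x = to_torus L z.
Proof. by exists (repr (x : Quotient.quot (in_lattice L))); rewrite /to_torus reprK. Qed.

Fact to_torus_is_additive (L : lattice) : additive (to_torus L).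
Proof. by move=> x y; rewrite /to_torus pi_addr pi_oppr. Qed.

HB.instance Definition _ (L : lattice) :=
  GRing.isAdditive.Build R[i] (torus L) (to_torus L) (to_torus_is_additive L).

(* The charts of a torus are the local inverses of [to_torus], so that a map
   between tori is holomorphic when it lifts locally to holomorphic functions.
   The scalar field of [derivable] is [R[i]]: this is complex
   differentiability. *)
Definition holomorphic_torus_map (L L' : lattice) (f : torus L -> torus L') :=
  forall z0 : (R[i])^o, exists F : (R[i])^o -> (R[i])^o,
    \forall z \near z0,
      derivable F z (1 : (R[i])^o) /\ f (to_torus L z) = to_torus L' (F z).

Definition isogeny (L L' : lattice) (f : {additive torus L -> torus L'}) :=
  holomorphic_torus_map f /\ exists x, f x != 0.

Definition isog_ker (L L' : lattice) (f : {additive torus L -> torus L'}) :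
  set (torus L) := [set x | f x = 0].

(* For [f] of degree [n]. *)
Definition dual_isogeny (n : nat) (L L' : lattice)
    (f : {additive torus L -> torus L'}) (g : {additive torus L' -> torus L}) :=
  isogeny g /\ forall x, g (f x) = x *+ n.

Definition subgroup_of_order (E : zmodType) (n : nat) (K : set E) :=
  [/\ K 0, forall x y, K x -> K y -> K (x - y) & (K #= `I_n)%card].

Definition cyclic_subgroup_of_order (E : zmodType) (n : nat) (K : set E) :=
  subgroup_of_order n K /\ exists g, K = [set g *~ m | m in [set: int]].

End Tori.

Section Moduli.
Variables (R : realType) (p : nat) (eps : int).

(* A pair [(E, phi)]; additive maps between groups killed by [p] are the same
   as ['F_p]-linear maps. *)
Record ns_pair := NsPair {
  ns_lattice : lattice R;
  ns_phi : {additive tors p (torus ns_lattice) -> tors p (torus ns_lattice)};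
  ns_phi_sqr : forall x, ns_phi (ns_phi x) = x *~ eps }.

HB.instance Definition _ := gen_eqMixin ns_pair.
HB.instance Definition _ := gen_choiceMixin ns_pair.

Definition ns_curve (x : ns_pair) : zmodType := torus (ns_lattice x).

Definition ns_iso (x y : ns_pair) :=
  exists (f : {additive ns_curve x -> ns_curve y})
         (g : {additive ns_curve y -> ns_curve x}),
  [/\ holomorphic_torus_map f, holomorphic_torus_map g,
      cancel f g, cancel g f &
      forall t, tors_map p f (ns_phi x t) = ns_phi y (tors_map p f t)].

(* Points of the modular curve are isomorphism classes of pairs, seen as sets. *)
Definition ns_point (x : ns_pair) : set ns_pair := [set y | ns_iso x y].

Definition ns_divisor := {freeg (set ns_pair)}.

(* [y] is the pair [(E', (1/n) f phi f^)] for an isogeny [f : E -> E'] with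
   kernel [K], a subgroup of order [n]; [1/n] is computed in ['F_p], whose
   elements are represented by natural numbers. *)
Definition ns_isogenous (n : nat) (x : ns_pair) (K : set (ns_curve x))
    (y : ns_pair) :=
  exists (f : {additive ns_curve x -> ns_curve y})
         (f' : {additive ns_curve y -> ns_curve x}),
  [/\ isogeny f, isog_ker f = K, dual_isogeny n f f' &
      forall t, ns_phi y t =
        tors_map p f (ns_phi x (tors_map p f' t)) *+ (n%:R^-1 : 'F_p)].

(* Two isogenies with the same kernel differ by an isomorphism of their
   targets, so the choice made by [xget] does not matter. *)
Definition hecke_geo_point (n : nat) (x : ns_pair) (K : set (ns_curve x)) :
  set ns_pair := ns_point (xget x (ns_isogenous n K)).

Definition hecke_geo (n : nat) (x : ns_pair) : ns_divisor :=
  \sum_(K \in [set K : set (ns_curve x) | cyclic_subgroup_of_order n K])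
    (<< hecke_geo_point n K >> : ns_divisor).

(* The same sum without the condition that the kernel be cyclic. For [n] not
   squarefree this is the right counterpart of [hecke_T] below, in which
   matrices whose entries have a common factor give non-cyclic kernels. *)
Definition hecke_geo_all (n : nat) (x : ns_pair) : ns_divisor :=
  \sum_(K \in [set K : set (ns_curve x) | subgroup_of_order n K])
    (<< hecke_geo_point n K >> : ns_divisor).

End Moduli.

Section TorusMap.
Variables (R : realType) (L L' : lattice R) (g : {additive R[i] -> R[i]}).
Hypothesis gL : forall z, lattice_set L z -> lattice_set L' (g z).

(* The group homomorphism induced by [g]. *)
Definition torus_map (x : torus L) : torus L' :=
  to_torus L' (g (repr (x : Quotient.quot (in_lattice L)))).

Lemma torus_mapE z : torus_map (to_torus L z) = to_torus L' (g z).
Proof.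
apply/to_torus_eq; rewrite -raddfB; apply/gL/to_torus_eq.
by rewrite /to_torus reprK.
Qed.

Fact torus_map_is_additive : additive torus_map.
Proof.
move=> x y; have [[u ->] [v ->]] := (to_torus_surj x, to_torus_surj y).
by rewrite -raddfB !torus_mapE !raddfB.
Qed.

End TorusMap.
Arguments torus_map {R} L L' g x.
Arguments torus_map_is_additive {R L L' g} gL.
Arguments torus_mapE {R L L' g} gL z.

Section UpperHalfPlane.
Variable R : realType.

Record upper_half := UpperHalf {
  uh_val : R[i]; uh_im_gt0 : 0 < complex.Im uh_val }.

HB.instance Definition _ := [isSub for uh_val].

Fact tau_lattice_subproof (tau : upper_half) :
  is_lattice [set z | exists a b : int, z = a%:~R * val tau + b%:~R * 1].
Proof. by exists (val tau), 1; split=> //; rewrite divr1 gt_eqF // uh_im_gt0. Qed.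

Definition tau_lattice (tau : upper_half) : lattice R :=
  Lattice (tau_lattice_subproof tau).

Variables (p : nat) (eps : int) (tau : upper_half).

(* The real-linear map sending [1] to [eps * tau] and [tau] to [1]. *)
Definition phi_lin (z : R[i]) : R[i] :=
  let x := complex.Im z / complex.Im (val tau) in
  let y := complex.Re z - x * complex.Re (val tau) in
  x%:C + y%:C * (eps%:~R * val tau).

Fact phi_lin_is_additive : additive phi_lin.
Proof.
move=> z w; rewrite /phi_lin !raddfB /=; ring.
Qed.

HB.instance Definition _ :=
  GRing.isAdditive.Build R[i] R[i] phi_lin phi_lin_is_additive.

Lemma phi_linE (x y : R) :
  phi_lin (x%:C * val tau + y%:C) = x%:C + y%:C * (eps%:~R * val tau).
Proof.
have v_neq0 : complex.Im (val tau) != 0 by rewrite gt_eqF // uh_im_gt0.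
have -> : x%:C * val tau + y%:C =
    (x * complex.Re (val tau) + y) +i* (x * complex.Im (val tau)).
  by case: (val tau) => u v; simpc.
by rewrite /phi_lin /= mulfK // [_ + y]addrC addrK.
Qed.

Fact phi_lin_lattice z :
  lattice_set (tau_lattice tau) z -> lattice_set (tau_lattice tau) (phi_lin z).
Proof.
move=> [a [b ->]]; exists (b * eps), a.
rewrite !mulr1 -[a%:~R](rmorph_int (real_complex R)).
rewrite -[b%:~R](rmorph_int (real_complex R)) phi_linE !rmorph_int rmorphM /=.
by rewrite mulrA addrC.
Qed.

Definition phi_torus :=
  torus_map (tau_lattice tau) (tau_lattice tau) phi_lin.

HB.instance Definition _ := GRing.isAdditive.Build
  (torus (tau_lattice tau)) (torus (tau_lattice tau)) phi_torus
  (torus_map_is_additive phi_lin_lattice).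

Lemma phi_torusE z : phi_torus (to_torus _ z) = to_torus _ (phi_lin z).
Proof. exact: (torus_mapE phi_lin_lattice). Qed.

Fact phi_torus_sqr x : phi_torus (phi_torus x) = x *~ eps.
Proof.
have [z ->] := to_torus_surj x; rewrite !phi_torusE -raddfMz; congr to_torus.
have [a [b ->]] : exists a b : R, z = a%:C * val tau + b%:C.
  exists (complex.Im z / complex.Im (val tau)).
  exists (complex.Re z - complex.Im z / complex.Im (val tau) * complex.Re (val tau)).
  have : complex.Im (val tau) != 0 by rewrite gt_eqF // uh_im_gt0.
  case: z (val tau) => [x1 x2] [u v] /= v_neq0; simpc.
  by rewrite divfK // [_ * _ + _]addrC subrK.
rewrite phi_linE mulrA addrC -(rmorph_int (real_complex R)) -rmorphM phi_linE.
by rewrite -mulrzl -(rmorph_int (real_complex R)) !rmorphM /=; ring.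
Qed.

Fact phi_tors_sqr (x : tors p (torus (tau_lattice tau))) :
  tors_map p phi_torus (tors_map p phi_torus x) = x *~ eps.
Proof. apply: val_inj; rewrite raddfMz; exact: phi_torus_sqr. Qed.

(* The pair [(E_tau, phi_tau)]. *)
Definition ns_pair_of : ns_pair R p eps := NsPair phi_tors_sqr.

Lemma phi_torus_invp :
  phi_torus (to_torus _ p%:R^-1) = to_torus _ (eps%:~R * val tau / p%:R).
Proof.
rewrite phi_torusE; congr to_torus.
rewrite [X in phi_lin X](_ : p%:R^-1 = (0 : R)%:C * val tau + (p%:R^-1)%:C); last first.
  by rewrite mul0r add0r fmorphV rmorph_nat.
by rewrite phi_linE rmorph0 add0r mulrC fmorphV rmorph_nat.
Qed.

Lemma phi_torus_taup :
  phi_torus (to_torus _ (val tau / p%:R)) = to_torus _ p%:R^-1.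
Proof.
rewrite phi_torusE; congr to_torus.
rewrite [X in phi_lin X](_ : val tau / p%:R = (p%:R^-1)%:C * val tau + (0 : R)%:C); last first.
  by rewrite rmorph0 addr0 mulrC fmorphV rmorph_nat.
by rewrite phi_linE rmorph0 mul0r addr0 fmorphV rmorph_nat.
Qed.

(* Only meant for matrices of positive determinant, in which case the default
   value of [insubd] is not used. *)
Definition mobius (a : 'M[int]_2) : upper_half :=
  insubd tau (((a 0 0)%:~R * val tau + (a 0 1)%:~R) /
              ((a 1 0)%:~R * val tau + (a 1 1)%:~R)).

Lemma mobius_val (a : 'M[int]_2) : 0 < \det a ->
  val (mobius a) = ((a 0 0)%:~R * val tau + (a 0 1)%:~R) /
                   ((a 1 0)%:~R * val tau + (a 1 1)%:~R).
Proof.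
move=> det_gt0; rewrite /mobius insubdK // unfold_in.
have := uh_im_gt0 tau; rewrite -[uh_val tau]/(val tau); case: (val tau) => u v /= v_gt0.
have {det_gt0} : 0 < (\det a)%:~R :> R by rewrite ltr0z.
rewrite (expand_det_row _ 0) !big_ord_recl big_ord0 /cofactor !det_mx11 !mxE.
rewrite -![_%:~R : R[i]](rmorph_int (real_complex R)) /=; simpc => /=.
rewrite (_ : fintype.lift 0 0 = 1); last exact: val_inj.
rewrite (_ : fintype.lift 1 0 = 0); last exact: val_inj.
rewrite -[ord0]/(0 : 'I_2) rmorphB !rmorphM /=.
move: (a 0 0)%:~R (a 0 1)%:~R (a 1 0)%:~R (a 1 1)%:~R => k l m n det_gt0.
set N := _ ^+ 2 + _ ^+ 2; have N_gt0 : 0 < N.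
  have N_ge0 : 0 <= N by rewrite addr_ge0 ?sqr_ge0.
  rewrite lt_def N_ge0 andbT; apply/negP.
  rewrite paddr_eq0 ?sqr_ge0 // !expf_eq0 /= mulf_eq0 (gt_eqF v_gt0) orbF.
  move=> /andP[+ /eqP m0]; rewrite m0 mul0r add0r => /eqP n0.
  by move: det_gt0; rewrite m0 n0 !mulr0 subr0 ltxx.
rewrite (_ : _ + _ = (k * n - l * m) * v / N); last by ring.
by rewrite divr_gt0 // mulr_gt0.
Qed.

End UpperHalfPlane.

Section HeckeAlgebra.
Variables (p : nat) (eps : int).

Implicit Types (a b g : 'M[int]_2) (G D : set 'M[int]_2).

Definition redp a : 'M['F_p]_2 := map_mx intr a.

Definition C_ns : set 'M['F_p]_2 :=
  [set g | g 0 0 = g 1 1 /\ g 1 0 = eps%:~R * g 0 1].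

Definition M_ns : set 'M[int]_2 := [set a | C_ns (redp a)].

Definition Gamma_ns : set 'M[int]_2 := [set a | M_ns a /\ \det a = 1].

Definition Gamma_p : set 'M[int]_2 := [set a | redp a = 1%:M /\ \det a = 1].

Definition Delta_ns : set 'M[int]_2 :=
  [set a | [/\ M_ns a, 0 < \det a & coprimez (\det a) p]].

Definition Delta_p : set 'M[int]_2 :=
  [set a | [/\ [/\ redp a 0 0 = 1, redp a 0 1 = 0 & redp a 1 0 = 0],
               0 < \det a & coprimez (\det a) p]].

(* The matrices allowed as [A_n]. *)
Definition is_twist (n : nat) a :=
  \det a = 1 /\ exists b,
    [/\ Delta_ns b, (\det b)%:~R = n%:R :> 'F_p &
        redp a = redp b *m \matrix_(i, j) (if i != j then 0 else
                             if i == 0 then 1 else n%:R^-1)].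

Definition lcoset G a : set 'M[int]_2 := [set g *m a | g in G].

Definition dcoset G a : set 'M[int]_2 :=
  [set c | exists g g', [/\ G g, G g' & c = g *m a *m g']].

(* The Hecke ring is the free abelian group on double cosets, seen as sets of
   matrices; its multiplication plays no role here. *)
Definition hecke_ring := {freeg (set 'M[int]_2)}.

Definition hecke_T (n : nat) : hecke_ring :=
  \sum_(D \in [set dcoset Gamma_p b | b in
                [set b | Delta_p b /\ \det b = n%:Z]]) (<< D >> : hecke_ring).

(* The linear map [h], where [A] is the chosen family of matrices [A_n]. The
   choice of [b] in the double coset does not matter: see [hecke_hE]. *)
Definition hecke_h (A : nat -> 'M[int]_2) : hecke_ring -> hecke_ring :=
  fglift (fun D => let b := xget 0 D in
            (<< dcoset Gamma_ns (A `|\det b|%N *m b) >> : hecke_ring)).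

(* The formal sum of the left cosets [G a] contained in a double coset, and its
   linear extension. *)
Definition left_cosets G : hecke_ring -> {freeg (set 'M[int]_2)} :=
  fglift (fun D => \sum_(c \in [set lcoset G a | a in D])
                     (<< c >> : {freeg (set 'M[int]_2)})).

Fact mulmx22 (K : pzRingType) (g g' : 'M[K]_2) i j :
  (g *m g') i j = g i 0 * g' 0 j + g i 1 * g' 1 j.
Proof.
rewrite mxE big_ord_recl big_ord1; congr (_ + g i _ * g' _ j); exact: val_inj.
Qed.

Fact adj22 (K : comPzRingType) (g : 'M[K]_2) :
  [/\ (\adj g) 0 0 = g 1 1, (\adj g) 0 1 = - g 0 1,
      (\adj g) 1 0 = - g 1 0 & (\adj g) 1 1 = g 0 0].
Proof.
have e1 : fintype.lift (0 : 'I_2) 0 = 1 by exact: val_inj.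
have e2 : fintype.lift (1 : 'I_2) 0 = 0 by exact: val_inj.
by split; rewrite !mxE /cofactor !det_mx11 !mxE ?e1 ?e2 /=
  ?expr0 ?expr1 ?mul1r ?mulN1r // ?expr2 ?mulrNN ?mul1r.
Qed.

Fact Gamma_ns_mul a b : Gamma_ns a -> Gamma_ns b -> Gamma_ns (a *m b).
Proof.
move=> [[h1 h2] da] [[h3 h4] db]; split; last by rewrite det_mulmx da db mulr1.
by split; rewrite /redp map_mxM !mulmx22 h1 h2 h3 h4; ring.
Qed.

Fact redpE a i j : redp a i j = (a i j)%:~R.
Proof. by rewrite mxE. Qed.

Fact Gamma_ns_adj a : Gamma_ns a -> Gamma_ns (\adj a).
Proof.
move=> [[]]; rewrite !redpE => h1 h2 da; split; last first.
  have := congr1 determinant (mul_mx_adj a).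
  by rewrite det_mulmx da mul1r det1.
have [e00 e01 e10 e11] := adj22 a.
by split; rewrite !redpE ?e00 ?e01 ?e10 ?e11 ?rmorphN /= ?h1 ?h2 ?mulrN.
Qed.

Fact dcoset_mul a h h' : Gamma_ns h -> Gamma_ns h' ->
  dcoset Gamma_ns (h *m a *m h') = dcoset Gamma_ns a.
Proof.
move=> Gh Gh'; apply/seteqP; split=> c [g [g' [Gg Gg' ->]]].
  exists (g *m h), (h' *m g'); split; try exact: Gamma_ns_mul.
  by rewrite !mulmxA.
exists (g *m \adj h), (\adj h' *m g').
split; try by apply: Gamma_ns_mul => //; apply: Gamma_ns_adj.
rewrite !mulmxA -(mulmxA g (\adj h)) mul_adj_mx (proj2 Gh) mulmx1.
by rewrite -(mulmxA _ h') mul_mx_adj (proj2 Gh') mulmx1.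
Qed.

Fact Gamma_p_conj a b : \det a = 1 -> Gamma_p b -> Gamma_ns (a *m b *m \adj a).
Proof.
move=> da [rb db]; split; last first.
  by rewrite !det_mulmx db mulr1 -det_mulmx mul_mx_adj da det1.
rewrite /M_ns /redp /= !map_mxM; rewrite /redp in rb; rewrite rb mulmx1.
by rewrite -map_mxM mul_mx_adj da map_mx1; split; rewrite !mxE //= mulr0.
Qed.

(* [X] is the sum of the left cosets [G a] for [a] in [s]. *)
Definition left_coset_expansion G (X : hecke_ring) (s : seq 'M[int]_2) :=
  left_cosets G X = \sum_(a <- s) << lcoset G a >>.

Definition primitive_mx a : bool :=
  gcdz (gcdz (a 0 0) (a 0 1)) (gcdz (a 1 0) (a 1 1)) == 1.

Lemma hecke_hE A b : \det (A `|\det b|%N) = 1 ->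
  hecke_h A << dcoset Gamma_p b >> =
  << dcoset Gamma_ns (A `|\det b|%N *m b) >>.
Proof.
move=> dA; rewrite /hecke_h liftU scale1r.
have Gp1 : Gamma_p 1%:M by split; rewrite ?det1 // /redp map_mx1.
have : dcoset Gamma_p b (xget 0 (dcoset Gamma_p b)).
  by apply: (@xgetPex _ 0); exists b, 1%:M, 1%:M; rewrite mulmx1 mul1mx.
move=> [g [g' [Gg Gg' ->]]]; congr << _ >>.
rewrite !det_mulmx (proj2 Gg) (proj2 Gg') mul1r mulr1.
set a := A _ in dA *.
rewrite -(@dcoset_mul (a *m b) (a *m g *m \adj a) g').
- by rewrite !mulmxA -(mulmxA _ (\adj a)) mul_adj_mx dA mulmx1.
- exact: Gamma_p_conj.
- have [rg dg] := Gg'; split=> //; rewrite /M_ns /= rg.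
  by split; rewrite !mxE //= mulr0.
Qed.

End HeckeAlgebra.

(* Main.v *)
Require Import Defs.
From HB Require Import structures.
From mathcomp Require Import all_boot all_order all_algebra.
From mathcomp Require Import boolp classical_sets reals freeg.
From mathcomp Require Import functions cardinality fsbigop complex finmap.
From mathcomp Require Import topology normedtype derive.
From mathcomp Require Import zify ring lra.
Import numFieldNormedType.Exports.
Import Order.TTheory GRing.Theory Num.Theory.
Local Open Scope ring_scope.

Set Implicit Arguments.
Unset Strict Implicit.
Unset Printing Implicit Defensive.

(** Both sides are indexed by the subgroups of order [n] of [E_tau].
    On the algebraic side, [Gamma_p]-double cosets of determinant [n] and
    [Gamma_ns]-double cosets in [M_ns] of determinant [n] correspond to each
    other, because [Gamma_p b Gamma_p] consists of the matrices of
    [SL_2(Z) b SL_2(Z)] congruent to [b] modulo [p] (lifting from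
    [SL_2(Z/np)]); hence [h(T_n)] is the sum, without multiplicities, of the
    cosets [Gamma_ns a] with [a] in [M_ns] of determinant [n].
    On the geometric side, such a coset is sent to the group [K_a] of the [z]
    with [n z] in the lattice spanned by [a_00 tau + a_01] and
    [D = a_10 tau + a_11]; it is the kernel of [z |-> n z / D] from [E_tau] to
    [E_(a tau)], whose dual is [z |-> D z].  Hermite normal forms show that
    [a |-> K_a] is a bijection from the cosets onto the subgroups of order [n],
    and [K_a] is cyclic if and only if [a] is primitive.  That [f phi f^ / n]
    is [phi_(a tau)] is exactly the condition that [a mod p] be in [C_ns].
    Finally, a holomorphic homomorphism of tori is a multiplication [z |-> c z],
    so that two isogenies with the same kernel have isomorphic targets. *)

(** * Sums over finite sets in free abelian groups *)

Section FiniteSums.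
Local Open Scope classical_set_scope.
Local Open Scope ring_scope.

Lemma mem_fset_set (T : choiceType) (C : set T) x : finite_set C ->
  (x \in fset_set C) <-> C x.
Proof. by move=> finC; rewrite in_fset_set //; split; [exact: set_mem | exact: mem_set]. Qed.

Lemma fglift_sum (T : choiceType) (M : lmodType int) (f : T -> M) (I : Type)
    (r : seq I) (P : pred I) (F : I -> {freeg T}) :
  fglift f (\sum_(i <- r | P i) F i) = \sum_(i <- r | P i) fglift f (F i).
Proof.
pose g : {additive {freeg T} -> M} :=
  HB.pack (fglift f) (GRing.isAdditive.Build _ _ _ (lift_is_additive f)).
exact: (raddf_sum g).
Qed.

(** Lets sums without multiplicities be compared by membership, one coefficient at a time. *)
Lemma coeff_fsum (T : choiceType) (C : set T) (c : T) : finite_set C ->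
  coeff c (\sum_(x \in C) (<< x >> : {freeg T})) = (c \in C)%:R.
Proof.
move=> finC; rewrite fsbig_finite // raddf_sum /=.
under eq_bigr do rewrite coeffU mul1r.
rewrite -in_fset_set //; have [cC|cC] := boolP (c \in fset_set C).
  rewrite (bigD1_seq c) //= eqxx big1_seq ?addr0 // => x /andP[xc _].
  by rewrite (negPf xc).
rewrite big1_seq // => x /andP[_ xC]; case: eqP => // xc.
by rewrite -xc xC in cC.
Qed.

End FiniteSums.

(** * Two-by-two matrices and lifting to [SL_2(Z)] *)

Definition mx22 (K : Type) (a b c d : K) : 'M[K]_2 :=
  \matrix_(i, j) if i == 0 then (if j == 0 then a else b)
                 else (if j == 0 then c else d).

Lemma mx22E (K : Type) (a b c d : K) : let M := mx22 a b c d in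
  (M 0 0 = a) * (M 0 1 = b) * (M 1 0 = c) * (M 1 1 = d).
Proof. by rewrite /mx22 /= !mxE /=. Qed.

Lemma ord2_cases (i : 'I_2) : i = 0 \/ i = 1.
Proof. by case: i => [[|[|//]] ilt]; [left|right]; exact: val_inj. Qed.

Lemma eq_mx22 (K : Type) (M N : 'M[K]_2) :
  M 0 0 = N 0 0 -> M 0 1 = N 0 1 -> M 1 0 = N 1 0 -> M 1 1 = N 1 1 -> M = N.
Proof.
move=> h1 h2 h3 h4; apply/matrixP=> i j.
by case: (ord2_cases i) => ->; case: (ord2_cases j) => ->.
Qed.

Lemma det22 (K : comPzRingType) (M : 'M[K]_2) :
  \det M = M 0 0 * M 1 1 - M 0 1 * M 1 0.
Proof.
have [e00 e01 e10 e11] := adj22 M.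
have := congr1 (fun X : 'M_2 => X 0 0) (mul_mx_adj M).
by rewrite /= mulmx22 e00 e10 mxE eqxx mulr1n mulrN => <-.
Qed.

Lemma mul_adj_mx22 (K : comPzRingType) (a b : 'M[K]_2) :
  \det a = 1 -> \adj a *m (a *m b) = b.
Proof. by move=> da; rewrite mulmxA mul_adj_mx da mul1mx. Qed.

Lemma det_adj22 (K : comPzRingType) (a : 'M[K]_2) : \det (\adj a) = \det a.
Proof.
have [e00 e01 e10 e11] := adj22 a.
by rewrite !det22 e00 e01 e10 e11; ring.
Qed.

(* Each prime divisor of [c] divides exactly one of [d] and [t * N]. *)
Lemma coprime_translate (N : nat) (c d : int) : c != 0 ->
  gcdn (gcdn `|c| `|d|) N = 1%N -> exists t : int, coprimez c (d + t * N%:Z).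
Proof.
move=> c0 cdN; pose t := (\prod_(q <- primes `|c| | ~~ (q %| `|d|)) q)%N.
have c_gt0 : (0 < `|c|)%N by rewrite absz_gt0.
exists t%:Z; rewrite /coprimez /gcdz -[1]/(1%:Z) eqz_nat.
apply: contraT => g1.
move: g1; set m := gcdn _ _ => g1; have {g1} /pdivP[q q_pr] : (1 < m)%N.
  by rewrite ltn_neqAle eq_sym g1 gcdn_gt0 c_gt0.
rewrite dvdn_gcd => /andP[qc].
rewrite -[(q %| _)%N]/(q%:Z %| d + t%:Z * N%:Z)%Z => qd.
have [qd1|qd1] := boolP (q %| `|d|)%N; last first.
  have qt : (q%:Z %| t%:Z)%Z.
    change (q %| t)%N; rewrite /t -big_filter (bigD1_seq q) ?dvdn_mulr //.
      by rewrite mem_filter qd1 mem_primes q_pr c_gt0.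
    by rewrite filter_uniq // primes_uniq.
  case/negP: qd1; change (q%:Z %| d)%Z.
  by rewrite -(addrK (t%:Z * N%:Z) d) rpredB // dvdz_mulr.
have : (q%:Z %| t%:Z * N%:Z)%Z by rewrite -(addKr d (_ * _)) addrC rpredB.
rewrite -PoszM -[(_ %| _)%Z]/(q %| t * N)%N Euclid_dvdM // => /orP[|qN]; last first.
  suff : (q %| 1)%N by rewrite dvdn1 => /eqP q1; rewrite q1 in q_pr.
  by rewrite -cdN !dvdn_gcd qc qd1.
apply: contraLR => _; rewrite /t big_seq_cond.
apply: (big_ind (fun x => ~~ (q %| x)%N)) => [|x y qx qy|r].
- by rewrite Euclid_dvd1.
- by rewrite Euclid_dvdM // negb_or qx.
rewrite mem_primes => /andP[/and3P[r_pr _ _]]; apply: contra => qr.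
by rewrite -(eqP (_ : q == r)) // -dvdn_prime2.
Qed.

(** As the determinant is 1 modulo [N], the bottom row has no common factor with [N]. Adding a
    multiple of [N] to its second entry makes it coprime, and Bezout coefficients then let the top
    row absorb any multiple of [N] in the determinant. *)
Lemma lift_SL2_lower (N : nat) (M : 'M[int]_2) :
  M 1 0 != 0 -> (N %| \det M - 1)%Z ->
  exists X, \det (M + N%:Z *: X) = 1.
Proof.
rewrite det22; set a := M 0 0; set b := M 0 1; set c := M 1 0; set d := M 1 1.
move=> c0 /dvdzP[k kE].
have [|t] := @coprime_translate N _ d c0.
  apply/eqP; rewrite -dvdn1; set g := gcdn _ _.
  have gN : (g%:Z %| N%:Z)%Z := dvdn_gcdr _ _.
  have gc : (g%:Z %| c)%Z := dvdn_trans (dvdn_gcdl _ _) (dvdn_gcdl _ _).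
  have gd : (g%:Z %| d)%Z := dvdn_trans (dvdn_gcdl _ _) (dvdn_gcdr _ _).
  rewrite -[(g %| 1)%N]/(g%:Z %| 1)%Z.
  have -> : 1%N%:Z = (a * d - b * c) - k * N%:Z by rewrite -kE; ring.
  by rewrite !rpredB // ?dvdz_mull.
move=> /coprimezP[[y x] /= xyE].
(* Replacing [d] by [d + t N] brings the determinant to [1 + (k + a t) N]; the top row cancels the
   excess because [y c + x (d + t N) = 1]. *)
exists (mx22 (- (k + a * t) * x) ((k + a * t) * y) 0 t).
rewrite det22 !mxE /= -/a -/b -/c -/d.
have {}kE : a * d = 1 + b * c + k * N by rewrite -kE; ring.
transitivity (a * d + a * t * N - b * c - (k + a * t) * N * (y * c + x * (d + t * N))).
  by ring.
by rewrite xyE kE; ring.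
Qed.

Lemma lift_SL2 (N : nat) (M : 'M[int]_2) : (0 < N)%N ->
  (N %| \det M - 1)%Z -> exists X, \det (M + N%:Z *: X) = 1.
Proof.
move=> N_gt0; have [c0|c0] := eqVneq (M 1 0) 0; last exact: lift_SL2_lower.
(* Adding [N] to the zero lower left entry changes the determinant by a multiple of [N]. *)
move=> NM; pose E := mx22 0 0 1 0 : 'M[int]_2.
have [||X XE] := @lift_SL2_lower N (M + N%:Z *: E).
- by rewrite !mxE /= c0; lia.
- rewrite det22 in NM; rewrite det22 !mxE /=.
  have -> : (M 0 0 + N%:Z * 0) * (M 1 1 + N%:Z * 0) -
     (M 0 1 + N%:Z * 0) * (M 1 0 + N%:Z * 1) - 1 =
     M 0 0 * M 1 1 - M 0 1 * M 1 0 - 1 - M 0 1 * N%:Z by ring.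
  by rewrite rpredB // dvdz_mull.
by exists (E + X); rewrite scalerDr addrA.
Qed.

Lemma intr_Zp_eq0 (N : nat) (x : int) : (1 < N)%N ->
  (x%:~R : 'Z_N) == 0 -> (N %| x)%Z.
Proof.
move=> N1; have natE (m : nat) : (m%:R : 'Z_N) == 0 -> (N %| m)%N.
  by move=> /eqP/(congr1 val) /=; rewrite val_Zp_nat // /dvdn => ->.
case: x => m; first exact: natE.
by rewrite NegzE rmorphN oppr_eq0 => /natE; rewrite /dvdz /=.
Qed.

(** * Matrices modulo p and double cosets *)

Section ModP.
Local Open Scope classical_set_scope.
Local Open Scope ring_scope.
Variables (p : nat) (p_prime : prime p).

Lemma intr_Fp_eq0 (x : int) : ((x%:~R : 'F_p) == 0) = (p %| x)%Z.
Proof. by rewrite -(dvdz_pcharf (pchar_Fp p_prime)). Qed.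

Lemma redpM a b : redp p (a *m b) = redp p a *m redp p b.
Proof. exact: map_mxM. Qed.

Lemma redpD a b : redp p (a + b) = redp p a + redp p b.
Proof. exact: map_mxD. Qed.

Lemma redpZ x a : redp p (x *: a) = x%:~R *: redp p a.
Proof. exact: map_mxZ. Qed.

Lemma redp1 : redp p 1%:M = 1%:M.
Proof. exact: map_mx1. Qed.

Lemma redp_pZ a : redp p (p%:Z *: a) = 0.
Proof. by rewrite redpZ [_%:~R](pcharf0 (pchar_Fp p_prime)) scale0r. Qed.

Lemma det_redp a : \det (redp p a) = (\det a)%:~R.
Proof. exact: det_map_mx. Qed.

Lemma redp_adj a : redp p (\adj a) = \adj (redp p a).
Proof. exact: map_mx_adj. Qed.

(** Integral representatives of the entries have determinant 1 modulo [p], and [lift_SL2] corrects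
    them by a multiple of [p]. *)
Lemma redp_lift (M : 'M['F_p]_2) : \det M = 1 ->
  exists g, \det g = 1 /\ redp p g = M.
Proof.
move=> dM; pose M0 : 'M[int]_2 := \matrix_(i, j) (val (M i j))%:Z.
have rM0 : redp p M0 = M.
  by apply/matrixP=> i j; rewrite !mxE [LHS]natr_Zp.
have [||X XE] := @lift_SL2 p M0; first exact: prime_gt0.
  by rewrite -intr_Fp_eq0 rmorphB /= -det_redp rM0 dM subrr.
by exists (M0 + p%:Z *: X); rewrite redpD redp_pZ addr0.
Qed.

(** The part of [u] that is nontrivial modulo [p] is carried across [b]: if [b w' = w b] with [w]
    congruent to [u], then [u b v = (u adj w) b (w' v)], where both outer factors are trivial modulo
    [p]. *)
Lemma Gamma_p_dcoset n (u b v : 'M[int]_2) : \det u = 1 -> \det v = 1 ->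
  \det b = n%:Z -> coprime n p -> (0 < n)%N -> redp p (u *m b *m v) = redp p b ->
  dcoset (Gamma_p p) b (u *m b *m v).
Proof.
move=> du dv db np n_gt0 rb.
have /coprimezP[[k l] /= kl] : coprimez n p by [].
(* [w] is congruent to [u] modulo [p] and to [1] modulo [n], so that
   [w' = b^-1 w b] is integral. *)
pose M0 := 1%:M + (k * n%:Z) *: (u - 1%:M).
have [||X] := @lift_SL2 (n * p) M0.
- by rewrite muln_gt0 n_gt0 prime_gt0.
- rewrite det22 /M0 !mxE /=; rewrite det22 in du.
  have kl' : k * n%:Z = 1 - l * p%:Z by rewrite -kl; ring.
  set e := k * n%:Z.
  (* With [e = k n] and [1 - e = l p], one has [det (1 + e (u - 1)) - 1 = e (1 - e) (tr u - 2)]. *)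
  apply/dvdzP; exists (k * l * (u 0 0 + u 1 1 - 2)).
  transitivity (e * (u 0 0 + u 1 1 - 2) + e * e * (2 - (u 0 0 + u 1 1))).
    have -> : 2 - (u 0 0 + u 1 1) = (u 0 0 * u 1 1 - u 0 1 * u 1 0) + 1 - (u 0 0 + u 1 1).
      by rewrite du; ring.
    ring.
  rewrite /e {3}kl' PoszM; ring.
set w := M0 + _ => dw.
pose Y := k *: (u - 1%:M) + p%:Z *: X.
have wY : w = 1%:M + n%:Z *: Y.
  rewrite /w /M0 /Y PoszM; apply/matrixP=> i j; rewrite !mxE; ring.
have rw : redp p w = redp p u.
  have -> : w = u + p%:Z *: (- l *: (u - 1%:M) + n%:Z *: X).
    have kl' : k * n%:Z = 1 - l * p%:Z by rewrite -kl; ring.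
    rewrite /w /M0 kl' PoszM; apply/matrixP=> i j; rewrite !mxE; ring.
  by rewrite redpD redp_pZ addr0.
pose w' := 1%:M + \adj b *m Y *m b.
have bw : b *m w' = w *m b.
  rewrite /w' wY mulmxDr mulmxDl mul1mx mulmx1 !mulmxA mul_mx_adj db.
  by rewrite mul_scalar_mx.
have n0 : \det b != 0 by rewrite db; lia.
have dw' : \det w' = 1.
  apply: (mulfI n0); rewrite mulr1 -{2}[\det b]mul1r -dw mulrC.
  by rewrite -[RHS]det_mulmx -bw det_mulmx mulrC.
exists (u *m \adj w), (w' *m v); split.
- split; last by rewrite det_mulmx det_adj22 du dw mulr1.
  by rewrite redpM redp_adj rw -redp_adj -redpM mul_mx_adj du redp1.
- split; last by rewrite det_mulmx dw' dv mulr1.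
  have rbU : redp p b \in unitmx.
    rewrite unitmxE det_redp db unitfE -[_%:~R]/(n%:R : 'F_p) -unitfE.
    by rewrite unitFpE // coprime_sym.
  (* Modulo [p], [b w' v = w b v = u b v = b], and the invertible [b] is cancelled. *)
  apply: (can_inj (mulKmx rbU)); rewrite mulmx1 redpM mulmxA -redpM bw -redpM.
  by rewrite !redpM rw -!redpM.
- by rewrite !mulmxA -(mulmxA _ b w') bw mulmxA -(mulmxA u (\adj w)) mul_adj_mx dw mulmx1.
Qed.

Variable eps : int.

Lemma Gamma_p_sub g : Gamma_p p g -> Gamma_ns p eps g.
Proof.
move=> [rg dg]; split=> //; rewrite /M_ns /= rg.
by split; rewrite !mxE //= mulr0.
Qed.

Lemma Gamma_ns1 : Gamma_ns p eps 1%:M.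
Proof. by apply: Gamma_p_sub; split; [exact: redp1 | exact: det1]. Qed.

Lemma C_ns_mul (g h : 'M['F_p]_2) : C_ns eps g -> C_ns eps h -> C_ns eps (g *m h).
Proof. by move=> [h1 h2] [h3 h4]; split; rewrite !mulmx22 h1 h2 h3 h4; ring. Qed.

Lemma C_ns_adj (g : 'M['F_p]_2) : C_ns eps g -> C_ns eps (\adj g).
Proof.
move=> [h1 h2]; have [e00 e01 e10 e11] := adj22 g.
by split; rewrite ?e00 ?e01 ?e10 ?e11 ?h1 ?h2 ?mulrN.
Qed.

Lemma C_nsZ x (g : 'M['F_p]_2) : C_ns eps g -> C_ns eps (x *: g).
Proof. by move=> [h1 h2]; split; rewrite !mxE ?h1 ?h2 // mulrCA. Qed.

Lemma lcosetP a c : lcoset (Gamma_ns p eps) a = lcoset (Gamma_ns p eps) c <->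
  exists2 g, Gamma_ns p eps g & c = g *m a.
Proof.
split=> [e|[g Gg ->]].
  have : lcoset (Gamma_ns p eps) c c by exists 1%:M; [exact: Gamma_ns1|rewrite mul1mx].
  by rewrite -e => -[g Gg <-]; exists g.
apply/seteqP; split=> _ [h Gh <-].
  exists (h *m \adj g); first by apply: Gamma_ns_mul => //; apply: Gamma_ns_adj.
  by rewrite -mulmxA mul_adj_mx22 // (proj2 Gg).
by exists (h *m g); [exact: Gamma_ns_mul|rewrite mulmxA].
Qed.

Variables (n : nat) (n_gt0 : (0 < n)%N) (n_coprime : coprime n p).

Definition Delta_ns_det : set 'M[int]_2 := [set a | M_ns p eps a /\ \det a = n%:Z].

Definition Delta_p_det : set 'M[int]_2 := [set b | Delta_p p b /\ \det b = n%:Z].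

Lemma n_Fp_neq0 : (n%:R : 'F_p) != 0.
Proof. by rewrite -unitfE unitFpE // coprime_sym. Qed.

Lemma redp_unit a : \det a = n%:Z -> redp p a \in unitmx.
Proof. by move=> da; rewrite unitmxE det_redp da unitfE n_Fp_neq0. Qed.

Lemma det_n_neq0 (a : 'M[int]_2) : \det a = n%:Z -> \det a != 0.
Proof. by move=> ->; lia. Qed.

Lemma Delta_p_detP b : Delta_p_det b <->
  redp p b = mx22 1 0 0 n%:R /\ \det b = n%:Z.
Proof.
split=> [[[[h1 h2 h3] d0 cop] db]|[rb db]]; split=> //.
  have := det_redp b; rewrite det22 h1 h2 db mul0r subr0 mul1r => h4.
  by apply: eq_mx22; rewrite mx22E.
by split; rewrite ?rb ?mx22E // db.
Qed.

Lemma Delta_ns_det_mul g a h : Gamma_ns p eps g -> Delta_ns_det a ->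
  Gamma_ns p eps h -> Delta_ns_det (g *m a *m h).
Proof.
move=> [Mg dg] [Ma da] [Mh dh]; split; last by rewrite !det_mulmx dg dh da mul1r mulr1.
by rewrite /M_ns /= !redpM; do !apply: C_ns_mul.
Qed.

(** Modulo [p], [g] is [c adj a / n], and [C_ns] is closed under products, adjugates and scalars. *)
Lemma Delta_ns_det_div g a c : Delta_ns_det a -> Delta_ns_det c -> c = g *m a ->
  Gamma_ns p eps g.
Proof.
move=> [Ma da] [Mc dc] cE; have dg : \det g = 1.
  apply: (mulIf (det_n_neq0 da)); rewrite mul1r -det_mulmx -cE dc da //.
split=> //; rewrite /M_ns /=.
have -> : redp p g = n%:R^-1 *: (redp p c *m \adj (redp p a)).
  rewrite cE redpM -mulmxA mul_mx_adj det_redp da mul_mx_scalar scalerA.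
  by rewrite mulVf ?scale1r // n_Fp_neq0.
by apply/C_nsZ/C_ns_mul => //; apply: C_ns_adj.
Qed.

(** * Double cosets of [Gamma_p] and of [Gamma_ns], related by the twist [A_n] *)

Section Twist.
Variables (A : 'M[int]_2) (A_twist : is_twist p eps n A).

Lemma det_twist : \det A = 1. Proof. by case: A_twist. Qed.

(** The factor diag(1, 1/n) of [A] modulo [p] cancels the reduction diag(1, n) of [b], so that [A b]
    is congruent to the matrix [B] of [M_ns]. *)
Lemma twist_Delta_ns_det b : Delta_p_det b -> Delta_ns_det (A *m b).
Proof.
move=> /Delta_p_detP[rb db].
have [dA [B [[MB _ _] dB rA]]] := A_twist.
split; last by rewrite det_mulmx dA mul1r.
rewrite /M_ns /= redpM rA rb -mulmxA (_ : _ *m mx22 _ _ _ _ = 1%:M) ?mulmx1 //.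
by apply: eq_mx22; rewrite mulmx22 !mx22E !mxE /=;
  rewrite ?(mulr0, mul0r, mulr1, mul1r, addr0, add0r) ?mulVf ?n_Fp_neq0.
Qed.

(** A lift [g] of [a^-1 B] modulo [p] lies in [Gamma_ns], and [b = adj A a g] then reduces to
    diag(1, n). *)
Lemma Delta_ns_det_twist a : Delta_ns_det a ->
  exists2 b, Delta_p_det b & dcoset (Gamma_ns p eps) (A *m b) a.
Proof.
move=> [Ma da].
have [dA [B [[MB _ _] dB rA]]] := A_twist.
pose M := invmx (redp p a) *m redp p B.
have [|g [dg rg]] := @redp_lift M.
  rewrite det_mulmx det_inv !det_redp da dB mulVr //.
  by rewrite unitfE n_Fp_neq0.
have dag : \det (\adj A *m a *m g) = n%:Z.
  by rewrite !det_mulmx det_adj22 dA da dg mul1r mulr1.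
have Gg : Gamma_ns p eps g.
  split=> //; rewrite /M_ns /= rg /M /invmx redp_unit //.
  rewrite det_redp da -scalemxAl; by apply/C_nsZ/C_ns_mul => //; apply: C_ns_adj.
exists (\adj A *m a *m g).
  apply/Delta_p_detP; split=> //.
  rewrite -[RHS]mul1mx -redp1 -(mul_adj_mx22 1%:M dA) mulmx1 redpM.
  rewrite !redpM -[RHS]mulmxA -mulmxA rg /M mulKVmx ?redp_unit //; congr (_ *m _).
  rewrite rA -mulmxA (_ : _ *m mx22 _ _ _ _ = 1%:M) ?mulmx1 //.
  by apply: eq_mx22; rewrite mulmx22 !mx22E !mxE /=;
    rewrite ?(mulr0, mul0r, mulr1, mul1r, addr0, add0r) ?mulVf ?n_Fp_neq0.
exists 1%:M, (\adj g); split; [exact: Gamma_ns1 | exact: Gamma_ns_adj |].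
rewrite mul1mx !mulmxA mul_mx_adj dA mul1mx -mulmxA mul_mx_adj dg.
by rewrite mulmx1.
Qed.

(** Here [b' = u b v] with [u] and [v] of determinant 1, and both [b] and [b'] reduce to diag(1, n),
    which is the situation of [Gamma_p_dcoset]. *)
Lemma twist_dcoset_inj b b' c : Delta_p_det b -> Delta_p_det b' ->
  dcoset (Gamma_ns p eps) (A *m b) c -> dcoset (Gamma_ns p eps) (A *m b') c ->
  dcoset (Gamma_p p) b b'.
Proof.
move=> /Delta_p_detP[rb db] /Delta_p_detP[rb' db'].
move=> [g [g' [[_ dg] [_ dg'] ->]]] [h [h' [[_ dh] [_ dh'] e]]].
have b'E : b' = (\adj A *m \adj h *m g *m A) *m b *m (g' *m \adj h').
  rewrite -(mul_adj_mx22 b' det_twist) -{1}(mul_adj_mx22 (A *m b') dh).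
  move/(congr1 (mulmx^~ (\adj h'))): e.
  rewrite -(mulmxA _ h') mul_mx_adj dh' mulmx1 => <-.
  by rewrite !mulmxA.
rewrite b'E; apply: (Gamma_p_dcoset (n := n)) => //; rewrite -?b'E ?rb ?rb' //.
  by rewrite !det_mulmx !det_adj22 det_twist dh dg !mul1r.
by rewrite !det_mulmx det_adj22 dh' dg' mul1r.
Qed.

End Twist.

(* Congruent matrices of determinant [n] modulo [n p] differ by an element of
   [Gamma_p], since [a' a^-1 = 1 + (a' - a) adj a / n]. *)
Lemma finite_image_congr (T : Type) (D : set 'M[int]_2) (F : 'M[int]_2 -> T) :
  D `<=` [set a | \det a = n%:Z] ->
  (forall g a, D a -> Gamma_p p g -> F (g *m a) = F a) -> finite_set (F @` D).
Proof.
move=> Dn FE; have np_gt1 : (1 < n * p)%N by have := prime_gt1 p_prime; nia.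
pose r (a : 'M[int]_2) : 'M['Z_(n * p)]_2 := map_mx intr a.
(* [F] factors through the finite set of residues modulo [n p]; the default 0 occurs only at
   residues that [D] does not meet. *)
pose G (s : 'M['Z_(n * p)]_2) := F (xget 0 [set a | D a /\ r a = s]).
apply: (@sub_finite_set _ _ (G @` setT)); last exact/finite_image/finite_finset.
move=> _ [a Da <-]; exists (r a) => //; rewrite /G.
have : [set a' | D a' /\ r a' = r a] (xget 0 [set a' | D a' /\ r a' = r a]).
  by apply: (@xgetPex _ 0); exists a.
move: (xget _ _) => a' [Da' ra].
have [X XE] : exists X, a' = a + (n * p)%N%:Z *: X.
  have h i j : ((n * p)%N %| a' i j - a i j)%Z.
    apply: intr_Zp_eq0 => //; rewrite rmorphB subr_eq0 /=.
    by move/matrixP: ra => /(_ i j); rewrite !mxE => ->.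
  exists (\matrix_(i, j) ((a' i j - a i j) %/ (n * p)%N)%Z).
  apply/matrixP=> i j; rewrite !mxE mulrC.
  by rewrite (divzK (h i j)) addrC subrK.
pose g := 1%:M + p%:Z *: (X *m \adj a).
have ga : a' = g *m a.
  rewrite /g mulmxDl mul1mx -scalemxAl -mulmxA mul_adj_mx (Dn _ Da) XE.
  by rewrite mul_mx_scalar scalerA -PoszM mulnC.
rewrite ga FE //; split; first by rewrite redpD redp1 redp_pZ addr0.
have n0 := det_n_neq0 (Dn _ Da).
by apply: (mulIf n0); rewrite mul1r -det_mulmx -ga (Dn _ Da) (Dn _ Da').
Qed.

Lemma Gamma_p_mul g h : Gamma_p p g -> Gamma_p p h -> Gamma_p p (g *m h).
Proof.
by move=> [rg dg] [rh dh]; split; rewrite ?redpM ?rg ?rh ?mulmx1 ?det_mulmx ?dg ?dh ?mulr1.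
Qed.

Lemma Gamma_p_adj g : Gamma_p p g -> Gamma_p p (\adj g).
Proof.
by move=> [rg dg]; split; rewrite ?det_adj22 // redp_adj rg -redp1 -redp_adj adj1.
Qed.

Lemma dcoset_Gamma_p_eq b c : dcoset (Gamma_p p) b c ->
  dcoset (Gamma_p p) c = dcoset (Gamma_p p) b.
Proof.
move=> [g [g' [Gg Gg' ->]]]; apply/seteqP; split=> _ [h [h' [Gh Gh' ->]]].
  by exists (h *m g), (g' *m h'); split; rewrite ?mulmxA //; apply: Gamma_p_mul.
exists (h *m \adj g), (\adj g' *m h'); split; last first.
- rewrite !mulmxA -(mulmxA h (\adj g)) mul_adj_mx (proj2 Gg) mulmx1.
  by rewrite -(mulmxA (h *m b) g') mul_mx_adj (proj2 Gg') mulmx1.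
- by apply: Gamma_p_mul => //; apply: Gamma_p_adj.
- by apply: Gamma_p_mul => //; apply: Gamma_p_adj.
Qed.

(** Conjugation by [A] moves the left factor from [Gamma_p] into [Gamma_ns], so the image of a
    double coset does not depend on its representative. *)
Lemma dcoset_twist A b c : \det A = 1 -> dcoset (Gamma_p p) b c ->
  dcoset (Gamma_ns p eps) (A *m c) = dcoset (Gamma_ns p eps) (A *m b).
Proof.
move=> dA [g [g' [Gg Gg' ->]]].
rewrite -(@dcoset_mul p eps (A *m b) (A *m g *m \adj A) g').
- by rewrite !mulmxA -(mulmxA _ (\adj A)) mul_adj_mx dA mulmx1.
- exact: Gamma_p_conj.
- exact: Gamma_p_sub.
Qed.

Lemma dcoset_Gamma_p_id b : dcoset (Gamma_p p) b b.
Proof.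
by exists 1%:M, 1%:M; rewrite mulmx1 mul1mx; do 2!split=> //; rewrite ?redp1 ?det1.
Qed.

Definition ns_cosets : set (set 'M[int]_2) :=
  [set lcoset (Gamma_ns p eps) a | a in Delta_ns_det].

Lemma finite_ns_cosets : finite_set ns_cosets.
Proof.
apply: finite_image_congr => [a []//|g a _ Gg].
by apply/esym/lcosetP; exists g => //; apply: Gamma_p_sub.
Qed.

(** Each coset of [ns_cosets] lies in the image of exactly one double coset of [T_n]: existence is
    [Delta_ns_det_twist], uniqueness is [twist_dcoset_inj]. Hence no multiplicities appear. *)
Lemma left_cosets_hecke_T (A : nat -> 'M[int]_2) : is_twist p eps n (A n) ->
  left_cosets (Gamma_ns p eps) (hecke_h p eps A (hecke_T p n)) =
  \sum_(c \in ns_cosets) (<< c >> : {freeg (set 'M[int]_2)}).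
Proof.
move=> tA; rewrite /hecke_T; set Sp := [set dcoset (Gamma_p p) b | b in _].
have finSp : finite_set Sp.
  apply: finite_image_congr => [b []//|g b _ Gg]; apply: dcoset_Gamma_p_eq.
  by exists g, 1%:M; split; rewrite ?mulmx1 //; split; [exact: redp1 | exact: det1].
(* The left cosets in the image of [D] under [h], described without choosing a representative of
   [D]. *)
pose Q D := [set lcoset (Gamma_ns p eps) a |
  a in [set a | exists2 b, Delta_p_det b /\ D = dcoset (Gamma_p p) b &
                           dcoset (Gamma_ns p eps) (A n *m b) a]].
have QS D : Q D `<=` ns_cosets.
  move=> _ [_ [b [Db _] [g [g' [Gg Gg' ->]]]] <-].
  exists (g *m (A n *m b) *m g') => //.
  by apply: Delta_ns_det_mul => //; apply: twist_Delta_ns_det.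
rewrite fsbig_finite // /hecke_h fglift_sum /left_cosets fglift_sum.
transitivity (\sum_(D <- fset_set Sp) \sum_(c \in Q D) (<< c >> : {freeg (set 'M[int]_2)})).
  apply: eq_big_seq => _ /(mem_fset_set _ finSp)[b Db <-].
  have := @hecke_hE p eps A b; rewrite /hecke_h (proj2 Db) => ->; last exact: det_twist tA.
  rewrite liftU scale1r; apply: eq_fsbigl; congr image; apply/seteqP; split=> [a|a].
    by exists b.
  move=> [b' [_ bb']]; rewrite (@dcoset_twist _ b) ?det_twist // bb'.
  exact: dcoset_Gamma_p_id.
apply/eqP/freeg_eqP => c; rewrite coeff_fsum ?raddf_sum /=; last exact: finite_ns_cosets.
have coefE D : D \in fset_set Sp ->
    coeff c (\sum_(x \in Q D) (<< x >> : {freeg (set 'M[int]_2)})) = (c \in Q D)%:R.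
  by move=> _; apply/coeff_fsum/sub_finite_set/finite_ns_cosets/QS.
rewrite (eq_big_seq _ coefE); have [cS|cS] := boolP (c \in ns_cosets); last first.
  rewrite big1_seq // => D _.
  by rewrite memNset // => /(QS _) /mem_set; exact/negP.
have [a Da ac] := set_mem cS.
have [b Db ab] := Delta_ns_det_twist tA Da.
have SD : dcoset (Gamma_p p) b \in fset_set Sp by apply/(mem_fset_set _ finSp); exists b.
have uniqD D : Q D c -> D = dcoset (Gamma_p p) b.
  move=> [a' [b' [Db' ->]] [g [g' [Gg Gg' a'E]]] a'c].
  have /lcosetP[h Gh ah] : lcoset (Gamma_ns p eps) a' = lcoset (Gamma_ns p eps) a.
    by rewrite a'c.
  apply/esym/dcoset_Gamma_p_eq/(twist_dcoset_inj tA Db' Db (c := a)) => //.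
  by exists (h *m g), g'; split=> //; rewrite ?ah ?a'E ?mulmxA //; apply: Gamma_ns_mul.
rewrite (bigD1_seq _ SD) ?fset_uniq //= big1_seq ?addr0 => [|D /andP[Db' _]].
  by rewrite mem_set //; exists a => //; exists b.
by rewrite memNset // => /uniqD /eqP; rewrite (negPf Db').
Qed.

End ModP.

(** * Holomorphic homomorphisms of complex tori *)

Section TorusMaps.
Local Open Scope classical_set_scope.
Local Open Scope complex_scope.
Local Open Scope ring_scope.
Variable R : realType.
Implicit Types (L : lattice R) (z c d : R[i]).

Local Notation normc := (@Normc.normc R).

Lemma normcC z : `|z| = (normc z)%:C.
Proof. by rewrite normc_def; case: z. Qed.

Lemma normc_ge0 z : 0 <= normc z.
Proof. by rewrite -lecR -normcC normr_ge0. Qed.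

Lemma normc_ge_absIm z : `|complex.Im z| <= normc z.
Proof.
by case: z => x y /=; rewrite -sqrtr_sqr ler_wsqrtr // lerDr sqr_ge0.
Qed.

Lemma normc_real (x : R) : normc x%:C = `|x|.
Proof. by rewrite /= expr0n addr0 sqrtr_sqr. Qed.

Lemma normc_int (m : int) : normc m%:~R = `|m%:~R : R|.
Proof. by rewrite -normc_real rmorph_int. Qed.

Lemma normc_eq0 z : (normc z == 0) = (z == 0).
Proof. by rewrite -(inj_eq (@complexI R)) -normcC normr_eq0. Qed.

(** With [t = w1 / w2], an element [w2 (a t + b)] has modulus at least [|w2| |Im t|] if [a] is
    nonzero, and at least [|w2|] if [a = 0] and [b] is nonzero. *)
Lemma lattice_discrete L :
  exists2 r : R, 0 < r & forall z, lattice_set L z -> normc z < r -> z = 0.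
Proof.
have [w1 [w2 [Im_neq0 LE]]] := latticeP L; rewrite LE.
set t := w1 / w2 in Im_neq0.
have w2_neq0 : w2 != 0 by apply: contraNneq Im_neq0 => w20; rewrite /t w20 invr0 mulr0.
have Nw2 : 0 < normc w2 by rewrite lt_neqAle normc_ge0 eq_sym normc_eq0 w2_neq0.
exists (normc w2 * Num.min `|complex.Im t| 1).
  by rewrite mulr_gt0 // lt_min ltr01 normr_gt0 Im_neq0.
move=> z [a [b zE]]; have {}zE : z = w2 * (a%:~R * t + b%:~R).
  by rewrite zE /t mulrDr mulrCA [w2 * (_ / _)]mulrC divfK // [w2 * _]mulrC.
rewrite zE Normc.normcM ltr_pM2l // lt_min => /andP[h1 h2].
have a0 : a = 0.
  apply: contraTeq h1 => a_neq0; rewrite -leNgt.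
  apply: le_trans (normc_ge_absIm _).
  have -> : complex.Im (a%:~R * t + b%:~R) = a%:~R * complex.Im t.
    rewrite -(rmorph_int (real_complex R)) -[b%:~R](rmorph_int (real_complex R)).
    by case: (t) => u v /=; simpc.
  by rewrite normrM ler_peMl // -intr_norm (ler_int _ 1) -gtz0_ge1 normr_gt0.
move: h2; rewrite a0 mul0r add0r normc_int -intr_norm ltrz1.
by rewrite -[1]add0r ltzD1 normr_le0 => /eqP ->; rewrite mulr0.
Qed.

Lemma torus_eq0 L z : to_torus L z = 0 <-> lattice_set L z.
Proof. by rewrite -[0](raddf0 (to_torus L)) to_torus_eq subr0. Qed.

(** The radius of a ball in [(R[i])^o] is a positive element of [R[i]], hence real; this passes to
    radii in [R], where real arithmetic applies. *)
Lemma near0_normc (P : R[i] -> Prop) :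
  (\forall z \near (0 : (R[i])^o), P z) <->
  exists2 e : R, 0 < e & forall z, normc z < e -> P z.
Proof.
split=> [/nbhs_normP[e /= e_gt0 eP]|[e e_gt0 eP]].
  have eE : e = (complex.Re e)%:C by rewrite RRe_real // gtr0_real.
  exists (complex.Re e); first by rewrite -ltcR -eE.
  by move=> z ze; apply: eP; rewrite /= sub0r normrN normcC eE ltcR.
apply/nbhs_normP; exists e%:C; first by rewrite /= ltcR.
by move=> z /=; rewrite sub0r normrN normcC ltcR; apply: eP.
Qed.

Lemma derivable0_normc (F : (R[i])^o -> (R[i])^o) : derivable F 0 (1 : (R[i])^o) ->
  exists c : R[i], forall e : R, 0 < e -> exists2 d : R, 0 < d &
    forall h, normc h < d -> normc (F h - F 0 - c * h) <= e * normc h.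
Proof.
move=> /cvg_ex[/= c Fc]; exists c => e e_gt0.
have /cvgrPdist_le/(_ e%:C) := Fc; rewrite ltcR => /(_ e_gt0).
rewrite /dnbhs /within /= => /near0_normc[d d_gt0 dP]; exists d => // h hd.
have [->|h_neq0] := eqVneq h 0; first by rewrite mulr0 !subr0 subrr Normc.normc0 mulr0.
have := dP h hd h_neq0; rewrite normcC lecR addr0 => le_e.
have -> : F h - F 0 - c * h = - (h * (c - h^-1 *: (F (h *: (1 : (R[i])^o)) - F 0))).
  rewrite [h *: 1]mulr1 -[h^-1 *: _]/(h^-1 * _) mulrBr mulVKf //; ring.
rewrite normcN Normc.normcM mulrC ler_wpM2r // normc_ge0 //.
Qed.

Lemma normc_2XM k z : normc (2 ^+ k * z) = 2 ^+ k * normc z.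
Proof.
rewrite Normc.normcM -(rmorph_nat (real_complex R)) -rmorphXn normc_real.
by rewrite ger0_norm // exprn_ge0.
Qed.

Lemma normc_half_le z k : normc (z / 2 ^+ k) <= normc z.
Proof.
have z2k : z = 2 ^+ k * (z / 2 ^+ k) by rewrite mulrCA divff ?mulr1 // expf_neq0 // pnatr_eq0.
rewrite {2}z2k normc_2XM ler_peMl ?normc_ge0 //.
by rewrite -natrX (ler_nat _ 1) expn_gt0.
Qed.

Lemma normc_half z (e : R) : 0 < e -> exists k : nat, normc (z / 2 ^+ k) < e.
Proof.
move=> e_gt0; exists (Num.bound (normc z / e)).
set k := Num.bound _.
rewrite -(ltr_pM2l (exprn_gt0 k (ltr0n R 2))) -normc_2XM mulrCA divff ?mulr1; last first.
  by rewrite expf_neq0 // pnatr_eq0.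
rewrite -ltr_pdivrMr //.
have := archi_boundP (divr_ge0 (normc_ge0 z) (ltW e_gt0)) => /lt_trans -> //.
by rewrite -natrX ltr_nat ltn_expl.
Qed.

(* The deviation [D] of a local lift from its linear part is [o(z)], and near
   [0] it satisfies [D (2 z) = 2 D z] because lattices are discrete; hence it
   vanishes there. *)
Lemma holomorphic_linear L L' (f : {additive torus L -> torus L'}) :
  holomorphic_torus_map f ->
  exists c, forall z, f (to_torus L z) = to_torus L' (c * z).
Proof.
move=> /(_ 0)[F nearF].
have [_ F0E] := nbhs_singleton nearF.
have F0 : lattice_set L' (F 0) by apply/torus_eq0; rewrite -F0E !raddf0.
have [c cP] := derivable0_normc (proj1 (nbhs_singleton nearF)).
have /near0_normc[d0 d0_gt0 d0P] :
    \forall z \near (0 : (R[i])^o), f (to_torus L z) = to_torus L' (F z).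
  by apply: filterS nearF => z [].
have [r r_gt0 rP] := lattice_discrete L'.
have [d1 d1_gt0 d1P] := cP 1 ltr01.
pose D z := F z - F 0 - c * z.
(* The bounds [d0 / 2] and [d1 / 2] keep [2 z] where the lift and the estimate hold; [r / 4] gives
   [|D (2 z) - 2 D z| <= 4 |z| < r]. *)
pose d := Num.min (Num.min (d0 / 2) (d1 / 2)) (r / 4).
have d_gt0 : 0 < d by rewrite !lt_min !divr_gt0.
have N2 z : normc (2 * z) = 2 * normc z.
  by have := normc_2XM 1 z; rewrite !expr1.
have dlt z : normc z < d -> [/\ normc z < d0 / 2, normc z < d1 / 2 & normc z < r / 4].
  by rewrite !lt_min => /andP[/andP[]].
have D2 z : normc z < d -> D (2 * z) = 2 * D z.
  move=> /dlt[z0 z1 zr]; have nz := normc_ge0 z; apply/eqP; rewrite -subr_eq0; apply/eqP/rP.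
    have -> : D (2 * z) - 2 * D z = F (2 * z) - F z *+ 2 + F 0 by rewrite /D; ring.
    have zd0 : normc z < d0 by lra.
    have z2d0 : normc (2 * z) < d0 by rewrite N2; lra.
    apply/torus_eq0; rewrite raddfD raddfB raddfMn /= -(d0P _ zd0) -(d0P _ z2d0).
    have -> : to_torus L (2 * z) = to_torus L z *+ 2 by rewrite mulr_natl raddfMn.
    by rewrite raddfMn subrr add0r; apply/torus_eq0.
  have := d1P (2 * z); have := d1P z; rewrite -!/(D _) N2 => h1 h2.
  have {}h1 : normc (D z) <= 1 * normc z by apply: h1; lra.
  have {}h2 : normc (D (2 * z)) <= 1 * (2 * normc z) by apply: h2; lra.
  have := le_normcD (D (2 * z)) (- (2 * D z)); rewrite normcN N2; lra.
have D2k k z : normc z < d -> D z = 2 ^+ k * D (z / 2 ^+ k).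
  elim: k => [|k IHk] zd; first by rewrite expr0 divr1 mul1r.
  have zd' : normc (z / 2 ^+ k.+1) < d := le_lt_trans (normc_half_le z k.+1) zd.
  have z2 : 2 * (z / 2 ^+ k.+1) = z / 2 ^+ k.
    by rewrite exprS invfM mulrCA mulVKf ?pnatr_eq0 // mulrC.
  by rewrite (IHk zd) -z2 (D2 _ zd') mulrA -exprSr.
have D0 z : normc z < d -> D z = 0.
  move=> zd; apply/eqP; apply: contraT => Dz_neq0.
  have Nz : 0 < normc z.
    rewrite lt_neqAle normc_ge0 eq_sym normc_eq0 andbT.
    by apply: contraNneq Dz_neq0 => ->; rewrite /D mulr0 subr0 subrr.
  have ND : 0 < normc (D z) by rewrite lt_neqAle normc_ge0 eq_sym normc_eq0 Dz_neq0.
  (* With this slope, [|D z| = 2^k |D (z / 2^k)| <= |D z| / 2] for large [k], a contradiction. *)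
  have [|e e_gt0 eP] := cP (normc (D z) / normc z / 2); first by rewrite !divr_gt0.
  have [k ke] := normc_half z e_gt0.
  have /eP := ke; rewrite -/(D _) => h.
  have : 2 ^+ k * normc (D (z / 2 ^+ k)) <=
         2 ^+ k * (normc (D z) / normc z / 2 * normc (z / 2 ^+ k)).
    by rewrite ler_wpM2l // exprn_ge0.
  rewrite -normc_2XM -D2k // mulrCA -normc_2XM mulrCA divff ?mulr1; last first.
    by rewrite expf_neq0 // pnatr_eq0.
  rewrite mulrAC divfK ?gt_eqF // => h'.
  have : normc (D z) <= 0 by lra.
  by rewrite leNgt ND.
(* Additivity spreads the formula from a neighbourhood of 0, since [z] is [2^k] times a small
   number. *)
exists c => z; have [k kd] := normc_half z d_gt0.
have z2k : z = (z / 2 ^+ k) *+ 2 ^ k.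
  by rewrite -mulr_natr natrX divfK // expf_neq0 // pnatr_eq0.
rewrite {1}z2k !raddfMn /= d0P; last by have [] := dlt _ kd; lra.
have -> : F (z / 2 ^+ k) = c * (z / 2 ^+ k) + F 0.
  by have /eqP := D0 _ kd; rewrite /D subr_eq0 subr_eq => /eqP.
have F00 : to_torus L' (F 0) = 0 by apply/torus_eq0.
by rewrite raddfD /= F00 addr0 -raddfMn /= -mulrnAr -z2k.
Qed.

Lemma linear_holomorphic L L' (f : {additive torus L -> torus L'}) c :
  (forall z, f (to_torus L z) = to_torus L' (c * z)) -> holomorphic_torus_map f.
Proof.
move=> fE z0; exists (c \*: id).
apply/nbhs_normP; exists 1 => /= [|z _]; first exact: ltr01.
split; last exact: fE.
exact/derivableZ/derivable_id.
Qed.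

Lemma torus_linear L L' c : (forall z, lattice_set L z -> lattice_set L' (c * z)) ->
  exists f : {additive torus L -> torus L'},
    forall z, f (to_torus L z) = to_torus L' (c * z).
Proof.
move=> cL; pose g : {additive R[i] -> R[i]} := c \*o idfun.
pose f : {additive torus L -> torus L'} := HB.pack (torus_map L L' g)
  (GRing.isAdditive.Build _ _ _ (@torus_map_is_additive _ L L' g cL)).
by exists f => z; apply: (@torus_mapE _ L L' g).
Qed.

(** Otherwise some [z] would make [(c - d) z] a nonzero lattice vector shorter than discreteness
    allows. *)
Lemma torus_linear_inj L c d :
  (forall z, to_torus L (c * z) = to_torus L (d * z)) -> c = d.
Proof.
move=> cd; have [r r_gt0 rP] := lattice_discrete L.
apply/eqP; rewrite -subr_eq0; apply: contraT => e_neq0.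
have Lr : lattice_set L (r / 2)%:C.
  apply/torus_eq0; rewrite -(mulfVK e_neq0 (r / 2)%:C) mulrC mulrBl raddfB /= cd subrr //.
have := rP _ Lr; rewrite normc_real ger0_norm ?divr_ge0 ?ltW //.
move=> h; have /complexI/eqP : (r / 2)%:C = 0%:C by apply: h; lra.
by rewrite gt_eqF // divr_gt0.
Qed.

Lemma torus_ext (L : lattice R) (T : Type) (f g : torus L -> T) :
  (forall z, f (to_torus L z) = g (to_torus L z)) -> f =1 g.
Proof. by move=> fg x; have [z ->] := to_torus_surj x. Qed.

(** * Isomorphisms of pairs and isogenies with a common kernel *)

Section Pairs.
Variables (p : nat) (eps : int).
Implicit Types x y : ns_pair R p eps.

Lemma ns_iso_sym x y : ns_iso x y -> ns_iso y x.
Proof.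
move=> [f [g [hf hg fK gK fg]]]; exists g, f; split=> // t.
have -> : t = tors_map p f (tors_map p g t) by apply: val_inj; rewrite /= gK.
rewrite -fg; apply: val_inj; rewrite /= fK; congr (val (ns_phi _ _)).
by apply: val_inj; rewrite /= gK.
Qed.

Lemma holomorphic_comp (L1 L2 L3 : lattice R) (f : {additive torus L1 -> torus L2})
    (g : {additive torus L2 -> torus L3}) :
  holomorphic_torus_map f -> holomorphic_torus_map g ->
  holomorphic_torus_map (g \o f).
Proof.
move=> /holomorphic_linear[c fE] /holomorphic_linear[d gE].
by apply: (@linear_holomorphic _ _ _ (d * c)) => z; rewrite /= fE gE mulrA.
Qed.

Lemma ns_iso_trans x y (z : ns_pair R p eps) : ns_iso x y -> ns_iso y z -> ns_iso x z.
Proof.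
move=> [f [g [hf hg fK gK fphi]]] [f' [g' [hf' hg' f'K g'K f'phi]]].
exists (f' \o f), (g \o g'); split; try exact: holomorphic_comp.
- exact: can_comp.
- exact: can_comp.
have tors_comp t : tors_map p (f' \o f) t = tors_map p f' (tors_map p f t).
  exact: val_inj.
by move=> t; rewrite !tors_comp fphi f'phi.
Qed.

Lemma ns_point_eq x y : ns_iso x y -> ns_point x = ns_point y.
Proof.
move=> xy; apply/seteqP; split=> z; last exact: ns_iso_trans.
by apply: ns_iso_trans; apply: ns_iso_sym.
Qed.

(** If the isogenies lift to multiplications by [c] and [d], equality of kernels says that
    multiplication by [d / c] carries one target lattice onto the other. It respects the
    endomorphisms because the duals are multiplications by [n / c] and [n / d]. *)
Lemma ns_isogenous_uniq n x (K : set (ns_curve x)) y y' : (0 < n)%N ->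
  ns_isogenous n K y -> ns_isogenous n K y' -> ns_iso y y'.
Proof.
move=> n_gt0 [f [f' [[hf _] fK [[hf' _] f'f] phiy]]].
move=> [g [g' [[hg _] gK [[hg' _] g'g] phiy']]].
have [c fE] := holomorphic_linear hf; have [c' f'E] := holomorphic_linear hf'.
have [d gE] := holomorphic_linear hg; have [d' g'E] := holomorphic_linear hg'.
have c'c : c' * c = n%:R.
  apply: (@torus_linear_inj (ns_lattice x)) => z.
  by rewrite -mulrA -f'E -fE f'f mulr_natl raddfMn.
have d'd : d' * d = n%:R.
  apply: (@torus_linear_inj (ns_lattice x)) => z.
  by rewrite -mulrA -g'E -gE g'g mulr_natl raddfMn.
have n_neq0 : n%:R != 0 :> R[i] by rewrite pnatr_eq0 -lt0n.
have c_neq0 : c != 0 by apply: contraNneq n_neq0 => c0; rewrite -c'c c0 mulr0.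
have d_neq0 : d != 0 by apply: contraNneq n_neq0 => d0; rewrite -d'd d0 mulr0.
have kerE z : lattice_set (ns_lattice y) (c * z) <-> lattice_set (ns_lattice y') (d * z).
  rewrite -!torus_eq0 -fE -gE.
  have : isog_ker f (to_torus _ z) <-> isog_ker g (to_torus _ z) by rewrite fK gK.
  by [].
have [|h hE] := @torus_linear (ns_lattice y) (ns_lattice y') (d / c).
  move=> z Lz; rewrite mulrAC -mulrA; apply/kerE.
  by rewrite mulrCA divff // mulr1.
have [|k kE] := @torus_linear (ns_lattice y') (ns_lattice y) (c / d).
  move=> z Lz; rewrite mulrAC -mulrA; apply/kerE.
  by rewrite mulrCA divff // mulr1.
exists h, k; split; try exact: linear_holomorphic.
- by apply: torus_ext => z; rewrite hE kE; congr to_torus; field; rewrite c_neq0 d_neq0.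
- by apply: torus_ext => z; rewrite kE hE; congr to_torus; field; rewrite c_neq0 d_neq0.
have hf_g : h \o f =1 g.
  by apply: torus_ext => z; rewrite /= fE hE gE; congr to_torus; field.
have g'h_f' : g' \o h =1 f'.
  apply: torus_ext => z; rewrite /= hE g'E f'E; congr to_torus.
  rewrite [RHS](_ : _ = n%:R / c * z); last by rewrite -c'c mulfK.
  by rewrite -d'd; field.
move=> t; rewrite phiy phiy' raddfMn; congr (_ *+ _); apply: val_inj.
rewrite /= -[LHS]/((h \o f) _) hf_g; congr (g (val (ns_phi _ _))); apply: val_inj.
by rewrite /= -g'h_f'.
Qed.

End Pairs.

End TorusMaps.

Lemma linear_isogeny (R : realType) (L L' : lattice R)
    (f : {additive torus L -> torus L'}) (c : R[i]) : c != 0 ->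
  (forall z, f (to_torus L z) = to_torus L' (c * z)) -> isogeny f.
Proof.
move=> c_neq0 fE; split; first exact: linear_holomorphic fE.
apply: contrapT => f0; move/eqP: c_neq0; apply.
apply: (@torus_linear_inj _ L') => z; rewrite -fE mul0r raddf0.
by apply: contrapT => fz; apply: f0; exists (to_torus L z); apply/eqP.
Qed.

Lemma to_torusMn (R : realType) (L : lattice R) (z : R[i]) (k : nat) :
  to_torus L (z *+ k) = to_torus L z *+ k.
Proof. exact: raddfMn. Qed.

(** The pair [(x, y)] stands for [x tau + y], so this is the lattice spanned by [a_00 tau + a_01]
    and [a_10 tau + a_11]. *)
Definition rowspan (a : 'M[int]_2) (x y : int) :=
  exists u v : int, x = u * a 0 0 + v * a 1 0 /\ y = u * a 0 1 + v * a 1 1.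

(** * Subgroups of [Z^2] and Hermite normal forms *)

Section Subgroup.
Variables (n : nat) (H : int -> int -> Prop).
Hypothesis H_sub : forall x y x' y', H x y -> H x' y' -> H (x - x') (y - y').
Hypothesis H_n0 : H n 0.

Lemma subgroup00 : H 0 0.
Proof. by have := H_sub H_n0 H_n0; rewrite !subrr. Qed.

Lemma subgroup_opp x y : H x y -> H (- x) (- y).
Proof. by move=> h; have := H_sub subgroup00 h; rewrite !sub0r. Qed.

Lemma subgroup_add x y x' y' : H x y -> H x' y' -> H (x + x') (y + y').
Proof. by move=> h /subgroup_opp/(H_sub h); rewrite !opprK. Qed.

Lemma subgroup_mul u x y : H x y -> H (u * x) (u * y).
Proof.
move=> h; have Hn (k : nat) : H (k%:Z * x) (k%:Z * y).
  elim: k => [|k IHk]; first by rewrite !mul0r; exact: subgroup00.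
  by rewrite -addn1 PoszD !mulrDl !mul1r; apply: subgroup_add.
by case: u => k //; rewrite NegzE !mulNr; apply: subgroup_opp.
Qed.

End Subgroup.

(** The generator is the least positive element: remainders modulo it stay in [P], hence vanish. *)
Lemma int_subgroup (P : int -> Prop) (N : int) :
  (forall x y, P x -> P y -> P (x - y)) -> P N -> 0 < N ->
  exists2 d : nat, (0 < d)%N & forall x, P x <-> (d %| x)%Z.
Proof.
move=> P_sub PN N_gt0.
have P0 : P 0 by rewrite -(subrr N); apply: P_sub.
have PN' x : P x -> P (- x) by rewrite -[- x]sub0r; apply: P_sub.
have PD x y : P x -> P y -> P (x + y) by move=> Px /PN'/(P_sub _ _ Px); rewrite opprK.
have PM (k x : int) : P x -> P (k * x).
  move=> Px; have Pn (m : nat) : P (m%:Z * x).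
    elim: m => [|m IHm]; first by rewrite mul0r.
    by rewrite -addn1 PoszD mulrDl mul1r; apply: PD.
  by case: k => m //; rewrite NegzE mulNr; apply: PN'.
pose Q := [pred d : nat | (0 < d)%N && `[< P d >]].
have exQ : exists d, Q d.
  exists `|N|%N; rewrite /= absz_gt0 gt_eqF //; apply/asboolP.
  by rewrite gez0_abs // ltW.
case: (ex_minnP exQ) => d /andP[d_gt0 /asboolP Pd] d_min; exists d => // x.
split=> [Px|/dvdzP[k ->]]; last exact: PM.
have Pm : P (x %% d)%Z.
  by have -> : (x %% d)%Z = x - (x %/ d)%Z * d by []; apply: P_sub => //; apply: PM.
have m_ge0 : 0 <= (x %% d)%Z by rewrite modz_ge0 //; lia.
have m_lt : (x %% d)%Z < d by apply: ltz_pmod; lia.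
apply/dvdz_mod0P; apply: contraTeq m_lt => m_neq0; rewrite -leNgt -(gez0_abs m_ge0) lez_nat.
by apply: d_min; rewrite /= absz_gt0 m_neq0 /=; apply/asboolP; rewrite gez0_abs.
Qed.

(** [d] generates the first coordinates of [H], [e] generates the second coordinates of the elements
    [(0, y)], and [(d, b)] is an element above [d]. *)
Lemma subgroup_hnf (H : int -> int -> Prop) (n : nat) : (0 < n)%N ->
  (forall x y x' y', H x y -> H x' y' -> H (x - x') (y - y')) -> H n 0 -> H 0 n ->
  exists (d e : nat) (b : int), [/\ (0 < d)%N, (0 < e)%N &
    forall x y, H x y <-> rowspan (mx22 d%:Z b 0 e%:Z) x y].
Proof.
move=> n_gt0 H_sub Hn0 H0n.
have [|||d d_gt0 dP] := @int_subgroup (fun x => exists y, H x y) n.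
- by move=> x y [x' h] [y' h']; exists (x' - y'); apply: H_sub.
- by exists 0.
- lia.
have [|||e e_gt0 eP] := @int_subgroup (fun y => H 0 y) n.
- by move=> x y h h'; rewrite -(subrr 0); apply: H_sub.
- by [].
- lia.
have [b Hb] : exists b, H d b by apply/dP.
have H_mul := @subgroup_mul n H H_sub Hn0.
have H_add := @subgroup_add n H H_sub Hn0.
exists d, e, b; split=> // x y; rewrite /rowspan !mx22E; split.
  move=> h; have /dvdzP[u xE] : (d %| x)%Z by apply/dP; exists y.
  have /dvdzP[v yE] : (e %| (y - u * b)%R)%Z.
    by apply/eP; rewrite -(subrr x) {2}xE; apply: H_sub => //; apply: H_mul.
  by exists u, v; split; rewrite -?yE ?xE; ring.
move=> [u [v [-> ->]]]; apply: H_add; first exact: H_mul.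
by rewrite mulr0; apply/eP; rewrite dvdz_mull.
Qed.

Lemma rowspan_sub_mul a b :
  (forall x y, rowspan a x y -> rowspan b x y) -> exists g, a = g *m b.
Proof.
move=> ab.
have [|u [v [h1 h2]]] := ab (a 0 0) (a 0 1); first by exists 1, 0; split; ring.
have [|u' [v' [h3 h4]]] := ab (a 1 0) (a 1 1); first by exists 0, 1; split; ring.
by exists (mx22 u v u' v'); apply: eq_mx22; rewrite mulmx22 !mx22E.
Qed.

Lemma rowspan_mul g a x y : rowspan (g *m a) x y -> rowspan a x y.
Proof.
move=> [u [v [-> ->]]]; rewrite !mulmx22.
by exists (u * g 0 0 + v * g 1 0), (u * g 0 1 + v * g 1 1); split; ring.
Qed.

Lemma rowspan_SL2 g a x y : \det g = 1 -> rowspan (g *m a) x y <-> rowspan a x y.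
Proof.
move=> dg; split; first exact: rowspan_mul.
by rewrite -{1}(mul_adj_mx22 a dg); exact: rowspan_mul.
Qed.

Lemma primitive_mx_dvd (a : 'M[int]_2) i j :
  let g := gcdz (gcdz (a 0 0) (a 0 1)) (gcdz (a 1 0) (a 1 1)) in
  (g %| (a i j)%R)%Z.
Proof.
case: (ord2_cases i) => ->; case: (ord2_cases j) => ->.
- exact: dvdz_trans (dvdz_gcdl _ _) (dvdz_gcdl _ _).
- exact: dvdz_trans (dvdz_gcdl _ _) (dvdz_gcdr _ _).
- exact: dvdz_trans (dvdz_gcdr _ _) (dvdz_gcdl _ _).
- exact: dvdz_trans (dvdz_gcdr _ _) (dvdz_gcdr _ _).
Qed.

(** Each matrix is a left multiple of the other, and cancelling [\det a] makes [\det g] a unit of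
    [Z]. *)
Lemma rowspan_det_sqr a b : \det a != 0 ->
  (forall x y, rowspan a x y <-> rowspan b x y) ->
  exists2 g, a = g *m b & \det g = 1 \/ \det g = -1.
Proof.
move=> da ab; have [g ag] : exists g, a = g *m b by apply: rowspan_sub_mul => x y /ab.
have [h bh] : exists h, b = h *m a by apply: rowspan_sub_mul => x y /ab.
exists g => //; have /eqP : \det g * \det h = 1.
  apply: (mulIf da); rewrite mul1r -!det_mulmx -mulmxA -bh -ag //.
move: (\det g) (\det h) => x y /eqP/(congr1 absz)/eqP.
rewrite abszM muln_eq1 => /andP[/eqP x1 _]; lia.
Qed.

(** * Kernels of isogenies *)

Section Exponent.
Local Open Scope classical_set_scope.
Local Open Scope ring_scope.

(** Translation by [x] permutes [K], so it preserves the sum of the elements of [K], to which it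
    adds [x *+ m]. *)
Lemma subgroup_exponent (E : zmodType) (m : nat) (K : set E) x :
  subgroup_of_order m K -> K x -> x *+ m = 0.
Proof.
move=> [K0 K_sub cardK] Kx.
have finK : finite_set K by apply/finite_setP; exists m.
have K_opp y : K y -> K (- y) by rewrite -[- y]sub0r; apply: K_sub.
have bijK : set_bij K K (fun y => y + x).
  split=> [y Ky|y y' _ _|y Ky]; first by rewrite /= -[x]opprK; apply/K_sub/K_opp.
    exact: addIr.
  by exists (y - x); [exact: K_sub|rewrite subrK].
have /eqP : \sum_(y \in K) y = \sum_(y \in K) (y + x) by exact: reindex_fsbig bijK.
rewrite fsbig_split //= addrC -subr_eq subrr eq_sym => /eqP.
by rewrite fsbig_finite // big_const_seq count_predT iter_addr_0 (card_fset_set cardK).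
Qed.

End Exponent.

Section Kernels.
Local Open Scope classical_set_scope.
Local Open Scope complex_scope.
Local Open Scope ring_scope.
Variables (R : realType) (tau : upper_half R) (n : nat) (n_gt0 : (0 < n)%N).

Local Notation t := (val tau).
Local Notation L := (tau_lattice tau).

Definition tau_pt (x y : int) : R[i] := x%:~R * t + y%:~R.

Lemma tau_ptB x y x' y' : tau_pt (x - x') (y - y') = tau_pt x y - tau_pt x' y'.
Proof. by rewrite /tau_pt !rmorphB /=; ring. Qed.

Lemma tau_pt_inj0 x y : tau_pt x y = 0 -> x = 0 /\ y = 0.
Proof.
rewrite /tau_pt -(rmorph_int (real_complex R)) -[y%:~R](rmorph_int (real_complex R)).
have := uh_im_gt0 tau; rewrite -[uh_val tau]/(val tau).
case: (val tau) => u v /= v_gt0; simpc => -[h1 h2].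
move/eqP: h2; rewrite mulf_eq0 (gt_eqF v_gt0) orbF intr_eq0 => /eqP x0.
by move/eqP: h1; rewrite x0 mul0r add0r intr_eq0 => /eqP.
Qed.

Lemma tau_lattice_pt x y : lattice_set L (tau_pt x y).
Proof. by exists x, y; rewrite mulr1. Qed.

Lemma tau_latticeP z : lattice_set L z -> exists x y, z = tau_pt x y.
Proof. by move=> [x [y ->]]; exists x, y; rewrite mulr1. Qed.

Lemma n_neq0 : n%:R != 0 :> R[i].
Proof. by rewrite pnatr_eq0 -lt0n. Qed.

Lemma tau_pt_divn x y x' y' :
  to_torus L (tau_pt x y / n%:R) = to_torus L (tau_pt x' y' / n%:R) <->
  (n %| x - x')%Z /\ (n %| y - y')%Z.
Proof.
rewrite to_torus_eq -mulrBl -tau_ptB; split.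
  move=> /tau_latticeP[u [v /(canRL (divfK n_neq0)) e]].
  have /tau_pt_inj0[/eqP + /eqP] :
      tau_pt (x - x' - u * n) (y - y' - v * n) = 0.
    rewrite tau_ptB e /tau_pt !rmorphM /=; ring.
  by rewrite !subr_eq0 => /eqP -> /eqP ->; rewrite !dvdz_mull.
move=> [/dvdzP[u ->] /dvdzP[v ->]].
rewrite (_ : tau_pt _ _ / _ = tau_pt u v); first exact: tau_lattice_pt.
rewrite /tau_pt !rmorphM /= -[n%:~R]/(n%:R) mulrAC -mulrDl mulfK //; exact: n_neq0.
Qed.

(** A subgroup of order [n] is killed by [n]; [H] collects the numerators of its points, written
    with denominator [n]. *)
Definition kernel_of (H : int -> int -> Prop) : set (torus L) :=
  [set w | exists x y, H x y /\ w = to_torus L (tau_pt x y / n%:R)].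

(** [H] contains [n Z^2], so membership does not depend on the choice of numerators. *)
Lemma kernel_ofP (H : int -> int -> Prop) x y :
  (forall x y x' y', H x y -> H x' y' -> H (x - x') (y - y')) -> H n 0 -> H 0 n ->
  kernel_of H (to_torus L (tau_pt x y / n%:R)) <-> H x y.
Proof.
move=> H_sub H_n0 H_0n; split=> [|h]; last by exists x, y.
move=> [x' [y' [h /tau_pt_divn[/dvdzP[u xE] /dvdzP[v yE]]]]].
have -> : x = u * n + (v * 0 + x') by rewrite mulr0 add0r -xE subrK.
have -> : y = u * 0 + (v * n + y') by rewrite mulr0 add0r -yE subrK.
by do 2![apply: (subgroup_add H_sub H_n0); first exact: (subgroup_mul H_sub H_n0)].
Qed.

Section Rowspan.
Variable a : 'M[int]_2.

Lemma rowspan_sub x y x' y' : rowspan a x y -> rowspan a x' y' ->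
  rowspan a (x - x') (y - y').
Proof.
move=> [u [v [-> ->]]] [u' [v' [-> ->]]]; exists (u - u'), (v - v'); split; ring.
Qed.

Hypothesis det_a : \det a = n%:Z.

(** The coefficients are a row of [\adj a], as [\adj a *m a] is the scalar [n]. *)
Lemma rowspan_n0 : rowspan a n 0.
Proof. by exists (a 1 1), (- a 0 1); rewrite -det_a det22; split; ring. Qed.

Lemma rowspan_0n : rowspan a 0 n.
Proof. by exists (- a 1 0), (a 0 0); rewrite -det_a det22; split; ring. Qed.

Lemma kernel_rowspanP x y :
  kernel_of (rowspan a) (to_torus L (tau_pt x y / n%:R)) <-> rowspan a x y.
Proof. by apply: kernel_ofP; [exact: rowspan_sub|exact: rowspan_n0|exact: rowspan_0n]. Qed.

End Rowspan.

Lemma mobius_isogenous p eps a : prime p -> coprime n p ->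
  Delta_ns_det p eps n a ->
  ns_isogenous n (x := ns_pair_of p eps tau) (kernel_of (rowspan a))
    (ns_pair_of p eps (mobius tau a)).
Proof.
move=> p_prime n_coprime [[ad cb] det_a].
have det_gt0 : 0 < \det a by rewrite det_a; lia.
have /dvdzP[r1 r1E] : (p %| (a 0 0 - a 1 1)%R)%Z.
  by rewrite -(intr_Fp_eq0 p_prime) rmorphB subr_eq0 /= -!redpE ad.
have /dvdzP[r2 r2E] : (p %| (a 1 0 - eps * a 0 1)%R)%Z.
  by rewrite -(intr_Fp_eq0 p_prime) rmorphB rmorphM subr_eq0 /= -!redpE cb.
pose D := tau_pt (a 1 0) (a 1 1).
pose L' := tau_lattice (mobius tau a); pose t' := val (mobius tau a).
have D_neq0 : D != 0.
  apply/eqP => /tau_pt_inj0[c0 d0]; move: det_gt0.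
  by rewrite det22 c0 d0 !mulr0 subrr ltxx.
have t'D : t' * D = tau_pt (a 0 0) (a 0 1) by rewrite /t' mobius_val // divfK.
have comb u v : (u%:~R * t' + v%:~R) * D =
    tau_pt (u * a 0 0 + v * a 1 0) (u * a 0 1 + v * a 1 1).
  rewrite mulrDl -mulrA t'D /D /tau_pt !rmorphD !rmorphM /=; ring.
have [f fE] : exists f : {additive torus L -> torus L'},
    forall z, f (to_torus L z) = to_torus L' (n%:R / D * z).
  apply: torus_linear => _ /tau_latticeP[x [y ->]].
  (* In coordinates, [z |-> n z / D] multiplies the row [(x, y)] by [\adj a]. *)
  exists (x * a 1 1 - y * a 1 0), (y * a 0 0 - x * a 0 1); rewrite mulr1.
  apply: (mulIf D_neq0); rewrite mulrAC divfK // comb.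
  rewrite -[n%:R]/(n%:Z%:~R) -det_a det22 /tau_pt.
  rewrite !(rmorphB, rmorphD, rmorphM) /=; ring.
have [f' f'E] : exists f' : {additive torus L' -> torus L},
    forall z, f' (to_torus L' z) = to_torus L (D * z).
  apply: torus_linear => _ [x [y ->]].
  by rewrite mulr1 -[val _]/t' mulrC comb; exact: tau_lattice_pt.
have Dn_neq0 : n%:R / D != 0 by rewrite mulf_neq0 ?invr_neq0 // n_neq0.
have f'f x : f' (f x) = x *+ n.
  have [z ->] := to_torus_surj x.
  rewrite fE f'E mulrA [D * _]mulrC divfK // mulr_natl; exact: raddfMn.
have ff' x : f (f' x) = x *+ n.
  have [z ->] := to_torus_surj x.
  rewrite f'E fE mulrA divfK // mulr_natl; exact: raddfMn.
exists f, f'; split.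
- exact: linear_isogeny fE.
- apply/seteqP; split=> [w|_ [x [y [[u [v [-> ->]]] ->]]]].
    have [z ->] := to_torus_surj w; rewrite /isog_ker /= fE => /torus_eq0[u [v]].
    rewrite mulr1 -[val _]/t' => zE.
    exists (u * a 0 0 + v * a 1 0), (u * a 0 1 + v * a 1 1); split; first by exists u, v.
    congr to_torus; apply: (mulIf n_neq0); rewrite divfK ?n_neq0 // -comb -zE.
    by rewrite mulrAC divfK // mulrC.
  rewrite /isog_ker /= fE; apply/torus_eq0; exists u, v.
  apply: (mulIf D_neq0); rewrite mulr1 -[val _]/t' comb mulrAC divfK // mulrC.
  by rewrite divfK // n_neq0.
- by split=> //; exact: linear_isogeny f'E.
(* [m] is the natural number representing [1/n] in ['F_p]. *)
set m := (_^-1); have nm : (p %| n%:Z * m%:Z - 1)%Z.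
  rewrite -(intr_Fp_eq0 p_prime) rmorphB rmorphM /= subr_eq0.
  rewrite -[_%:~R]/(n%:R) -[m%:~R]/(m%:R) natr_Zp divff //.
  exact: n_Fp_neq0.
have p_neq0 : p%:R != 0 :> R[i] by rewrite pnatr_eq0 -lt0n prime_gt0.
suff key (w : torus L') : w *+ p = 0 ->
    phi_torus eps w = f (@phi_torus R eps tau (f' w)) *+ m.
  move=> x; apply: val_inj; rewrite raddfMn; apply: key.
  by apply/eqP; exact: (valP x).
move=> wp.
(* Once [phi] commutes with the dual isogeny, [f phi f' m] becomes [f f' phi m = n m phi], which is
   [phi] on [p]-torsion. *)
have phi_comm : @phi_torus R eps tau (f' w) = f' (@phi_torus R eps (mobius tau a) w).
  have [z zE] := to_torus_surj w.
  have [X [Y XY]] : lattice_set L' (z *+ p).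
    by apply/torus_eq0; rewrite to_torusMn -zE.
  rewrite mulr1 -[val _]/t' in XY.
  have castE (k : int) : (k%:~R / p%:R : R)%:C = k%:~R / p%:R :> R[i].
    by rewrite rmorphM fmorphV rmorph_int rmorph_nat.
  have zXY : z = (X%:~R / p%:R)%:C * t' + (Y%:~R / p%:R)%:C.
    apply: (mulIf p_neq0); rewrite mulr_natr XY !castE.
    by field.
  have DzE : D * z = ((X * a 0 0 + Y * a 1 0)%:~R / p%:R)%:C * t +
                     ((X * a 0 1 + Y * a 1 1)%:~R / p%:R)%:C.
    apply: (mulIf p_neq0); rewrite -mulrA mulr_natr XY mulrC comb !castE /tau_pt.
    by field.
  rewrite zE f'E !phi_torusE f'E to_torus_eq DzE phi_linE zXY phi_linE -/t' !castE.
  have a00E : a 0 0 = a 1 1 + r1 * p by rewrite -r1E; ring.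
  have a10E : a 1 0 = eps * a 0 1 + r2 * p by rewrite -r2E; ring.
  (* The coordinates of the difference are combinations of [a_00 - a_11 = r1 p] and
     [a_10 - eps a_01 = r2 p], divided by [p]: membership in [C_ns] makes them integral. *)
  exists (- (X * r2 + Y * eps * r1)), (X * r1 + Y * r2); rewrite mulr1.
  rewrite (_ : D * _ = X%:~R / p%:R * D + Y%:~R / p%:R * eps%:~R * (t' * D)); last by ring.
  rewrite t'D /D /tau_pt a10E a00E !(rmorphN, rmorphD, rmorphM) /=.
  rewrite -![p%:~R]/(p%:R); by field.
rewrite phi_comm ff' -mulrnA.
case/dvdzP: nm => k kE; set s := phi_torus _ _.
have sp : s *+ p = 0 by rewrite -raddfMn wp raddf0.
rewrite pmulrn PoszM (_ : n%:Z * m%:Z = p%:Z * k + 1); last first.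
  by rewrite [p%:Z * k]mulrC -kE subrK.
by rewrite mulrzDr mulrzA -pmulrn sp mul0rz add0r.
Qed.

(** Every point comes from exactly one combination of [i] first rows and [j] second rows with
    [i < n / d] and [j < n / e]; the pair is coded as [k = i (n / e) + j]. *)
Lemma card_kernel_hnf (d e : nat) (b : int) : (0 < d)%N -> (0 < e)%N ->
  let H := rowspan (mx22 d%:Z b 0 e%:Z) in H n 0 -> H 0 n ->
  [/\ (d %| n)%N, (e %| n)%N & (kernel_of H #= `I_((n %/ d) * (n %/ e)))%card].
Proof.
move=> d_gt0 e_gt0 H H_n0 H_0n.
have H_sub : forall x y x' y', H x y -> H x' y' -> H (x - x') (y - y') by exact: rowspan_sub.
have HE x y : H x y <-> exists u v : int, x = u * d /\ y = u * b + v * e.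
  rewrite /H /rowspan !mx22E.
  by split=> -[u [v [-> ->]]]; exists u, v; split; ring.
have dn : (d %| n)%N.
  by have /HE[u [v [nE _]]] := H_n0; change (d%:Z %| n%:Z)%Z; rewrite nE dvdz_mull.
have H0 y : H 0 y -> (e %| y)%Z.
  move=> /HE[u [v [/esym/eqP]]]; rewrite mulf_eq0 => /orP[/eqP ->|]; last by lia.
  by rewrite mul0r add0r => ->; rewrite dvdz_mull.
have en : (e %| n)%N by exact: H0 H_0n.
split=> //; set q := (n %/ d)%N; set s := (n %/ e)%N.
have qd : (q * d)%N = n by rewrite divnK.
have se : (s * e)%N = n by rewrite divnK.
have q_gt0 : (0 < q)%N by rewrite divn_gt0 // dvdn_leq.
have s_gt0 : (0 < s)%N by rewrite divn_gt0 // dvdn_leq.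
(* [n / d] times the first row is [n] times a unit vector up to a multiple of
   the second row. *)
have [w wE] : exists w : int, q%:Z * b = w * e%:Z.
  apply/dvdzP/H0; have := H_sub _ _ _ _ (_ : H (q%:Z * d%:Z) (q%:Z * b)) H_n0.
  rewrite -PoszM qd subrr subr0; apply; apply/HE; exists q%:Z, 0.
  by rewrite -PoszM qd; split=> //; ring.
pose h (k : nat) := to_torus L
  (tau_pt ((k %/ s)%N%:Z * d) ((k %/ s)%N%:Z * b + (k %% s)%N%:Z * e) / n%:R).
have -> : kernel_of H = h @` `I_(q * s).
  apply/seteqP; split=> [_ [x [y [/HE[u [v [-> ->]]] ->]]]|_ [k _ <-]]; last first.
    exists ((k %/ s)%N%:Z * d), ((k %/ s)%N%:Z * b + (k %% s)%N%:Z * e); split=> //.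
    by apply/HE; exists (k %/ s)%N%:Z, (k %% s)%N%:Z.
  (* Removing [(u %/ q) q] first rows carries [(u %/ q) w] second rows over to [v], by [wE]. *)
  pose i := `|(u %% q)%Z|%N; pose v' := (u %/ q)%Z * w + v; pose j := `|(v' %% s)%Z|%N.
  have iE : i%:Z = (u %% q)%Z by rewrite gez0_abs // modz_ge0 //; lia.
  have jE : j%:Z = (v' %% s)%Z by rewrite gez0_abs // modz_ge0 //; lia.
  have i_lt : (i < q)%N by rewrite -ltz_nat iE ltz_pmod //; lia.
  have j_lt : (j < s)%N by rewrite -ltz_nat jE ltz_pmod //; lia.
  exists (i * s + j)%N.
    rewrite /=; apply: (@leq_trans (i.+1 * s)); last by rewrite leq_mul2r i_lt orbT.
    by rewrite mulSn addnC ltn_add2r.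
  rewrite /h divnMDl // divn_small // addn0 modnMDl modn_small //.
  apply/tau_pt_divn; split.
    rewrite iE -mulrBl -[(u %% q)%Z](addKr ((u %/ q)%Z * q)) -divz_eq.
    apply/dvdzP; exists (- (u %/ q)%Z); rewrite -qd PoszM; ring.
  apply/dvdzP; exists (- (v' %/ s)%Z).
  have uE := divz_eq u q; have vE := divz_eq v' s.
  rewrite iE jE -se PoszM {2}uE.
  have -> : v = v' - (u %/ q)%Z * w by rewrite /v'; ring.
  have vE' : v' * e = ((v' %/ s)%Z * s + (v' %% s)%Z) * e by rewrite -vE.
  transitivity ((v' %% s)%Z * e - (u %/ q)%Z * (q%:Z * b) - v' * e + (u %/ q)%Z * w * e).
    by ring.
  by rewrite wE vE'; ring.
apply: inj_card_eq => k k' /set_mem /= k_lt /set_mem /= k'_lt /tau_pt_divn[].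
have small (m i i' : nat) : (i < m)%N -> (i' < m)%N -> (m %| i%:Z - i'%:Z)%Z -> i = i'.
  move=> im im'; rewrite -eqz_mod_dvd !modz_small ?ltz_nat //.
  by move=> /eqP[].
have ks_lt : (k %/ s < q)%N by rewrite ltn_divLR.
have ks'_lt : (k' %/ s < q)%N by rewrite ltn_divLR.
have [d0 e0] : (d%:Z != 0) /\ (e%:Z != 0) by lia.
rewrite -mulrBl -qd PoszM dvdz_mul2r // => /(small _ _ _ ks_lt ks'_lt) kk.
rewrite kk opprD addrACA subrr add0r -mulrBl -PoszM qd -se PoszM dvdz_mul2r //.
move=> /small; rewrite !ltn_pmod // => /(_ isT isT) kk'.
by rewrite (divn_eq k s) kk kk' -divn_eq.
Qed.

Lemma kernel_of_ext (H H' : int -> int -> Prop) :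
  (forall x y, H x y <-> H' x y) -> kernel_of H = kernel_of H'.
Proof.
by move=> HH'; apply/seteqP; split=> w [x [y [/HH' h wE]]]; exists x, y.
Qed.

(** The Hermite form has the same determinant up to sign, so [d e = n] and the count
    [(n / d) (n / e)] is [n]. *)
Lemma kernel_order a : \det a = n%:Z -> subgroup_of_order n (kernel_of (rowspan a)).
Proof.
move=> da.
have [d [e [b [d_gt0 e_gt0 aE]]]] :=
  subgroup_hnf n_gt0 (@rowspan_sub a) (rowspan_n0 da) (rowspan_0n da).
have da0 : \det a != 0 by rewrite da; lia.
have [g aE' dg] := rowspan_det_sqr da0 aE.
have den : n = (d * e)%N.
  have := da; rewrite aE' det_mulmx [\det (mx22 _ _ _ _)]det22 !mx22E.
  by case: dg => ->; lia.
split.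
- exists 0, 0; split; last by rewrite /tau_pt !mul0r addr0 mul0r raddf0.
  by exists 0, 0; split; ring.
- move=> _ _ [x [y [h ->]]] [x' [y' [h' ->]]]; exists (x - x'), (y - y').
  by split; [exact: rowspan_sub|rewrite tau_ptB mulrBl raddfB].
- rewrite (kernel_of_ext aE).
  have [||_ _] := @card_kernel_hnf d e b d_gt0 e_gt0.
  - exact/aE/rowspan_n0.
  - exact/aE/rowspan_0n.
  by rewrite den mulKn // mulnK // mulnC.
Qed.

(** The numerators of [K] form a subgroup with a Hermite basis, and the count [(n / d) (n / e) = n]
    forces its determinant [d e] to be [n]. *)
Lemma order_kernel (K : set (torus L)) : subgroup_of_order n K ->
  exists2 a, \det a = n%:Z & K = kernel_of (rowspan a).
Proof.
move=> hK; have [K0 K_sub cardK] := hK.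
pose H x y := K (to_torus L (tau_pt x y / n%:R)).
have KE : K = kernel_of H.
  apply/seteqP; split=> [w Kw|_ [x [y [h ->]]]//].
  have [z zE] := to_torus_surj w.
  have [x [y xy]] : exists x y, z *+ n = tau_pt x y.
    apply/tau_latticeP/torus_eq0; rewrite to_torusMn -zE.
    exact: subgroup_exponent hK Kw.
  have z_xy : z = tau_pt x y / n%:R 
    by apply: (mulIf n_neq0); rewrite divfK ?n_neq0 // mulr_natr.
  by exists x, y; rewrite /H -z_xy -zE.
have H_sub x y x' y' : H x y -> H x' y' -> H (x - x') (y - y').
  by move=> h h'; rewrite /H tau_ptB mulrBl raddfB; apply: K_sub.
have H_lat x y : H (x * n) (y * n).
  rewrite /H (_ : to_torus _ _ = 0) //; apply/torus_eq0.
  rewrite (_ : _ / _ = tau_pt x y); first exact: tau_lattice_pt.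
  by apply: (mulIf n_neq0); rewrite divfK ?n_neq0 // /tau_pt !rmorphM /= -[n%:~R]/(n%:R); ring.
have H_n0 : H n 0 by have := H_lat 1 0; rewrite mul1r mul0r.
have H_0n : H 0 n by have := H_lat 0 1; rewrite mul1r mul0r.
have [d [e [b [d_gt0 e_gt0 HE]]]] := subgroup_hnf n_gt0 H_sub H_n0 H_0n.
have KE' : K = kernel_of (rowspan (mx22 d%:Z b 0 e%:Z)) by rewrite KE; exact: kernel_of_ext.
exists (mx22 d%:Z b 0 e%:Z) => //.
have [||dn en] := @card_kernel_hnf d e b d_gt0 e_gt0; [exact/HE|exact/HE|].
rewrite -KE' => cardK'.
have /card_eq_II nE : (`I_n #= `I_((n %/ d) * (n %/ e)))%card.
  by rewrite -(card_eql cardK).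
rewrite det22 !mx22E mulr0 subr0 -PoszM; congr Posz.
have := divnK dn; have := divnK en; nia.
Qed.

Lemma kernel_rowspan_inj a a' : \det a = n%:Z -> \det a' = n%:Z ->
  kernel_of (rowspan a) = kernel_of (rowspan a') -> exists g, a' = g *m a.
Proof.
move=> da da' KE; apply: rowspan_sub_mul => x y h.
by apply/(kernel_rowspanP da); rewrite KE; apply/(kernel_rowspanP da').
Qed.

(** [g] lifts [b a^-1] modulo [p], so that [g a] is congruent to [b]; thus a row lattice can be
    given a basis matrix in [M_ns]. *)
Lemma exists_Delta_ns_det p eps a b : prime p -> coprime n p -> \det a = n%:Z ->
  M_ns p eps b -> (\det b)%:~R = n%:R :> 'F_p ->
  exists2 g, \det g = 1 & Delta_ns_det p eps n (g *m a).
Proof.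
move=> p_prime n_coprime da Mb db.
have ua := redp_unit p_prime n_coprime da.
have [|g [dg rg]] := @redp_lift p p_prime (redp p b *m invmx (redp p a)).
  rewrite det_mulmx det_inv !det_redp da db divrr //.
  by rewrite unitfE n_Fp_neq0.
exists g => //; split; last by rewrite det_mulmx dg mul1r.
by rewrite /M_ns /= redpM rg mulmxKV.
Qed.

(* By the Smith normal form, some combination of the rows of [a] extends to a
   basis of [Z^2]; every other combination is congruent modulo [n = det a] to
   a multiple of it. *)
Lemma cyclic_kernel a : \det a = n%:Z -> primitive_mx a ->
  cyclic_subgroup_of_order n (kernel_of (rowspan a)).
Proof.
move=> da prim_a; split; first exact: kernel_order.
have [U uU [V uV [s s_sorted aE]]] := int_Smith_normal_form a.
set S : 'M[int]_2 := \matrix_(i, j) _ in aE.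
have SE : S = mx22 s`_0 0 0 s`_1.
  by apply: eq_mx22; rewrite /S !mxE.
have s0V i j : a i j = s`_0 * (U i 0 * V 0 j) + s`_1 * (U i 1 * V 1 j).
  by rewrite aE SE !mulmx22 !mx22E; ring.
have s_dvd : (s`_0 %| s`_1)%Z by case: s s_sorted {aE S SE s0V} => [|x [|y s]] //= /andP[].
(* The first invariant factor divides all entries of [a], hence their gcd, which is 1. *)
have [c cE] : exists c, 1 = c * s`_0.
  apply/dvdzP; have s0a i j : (s`_0 %| a i j)%Z.
    by rewrite s0V rpredD // dvdz_mulr.
  by move: prim_a => /eqP <-; rewrite !dvdz_gcd !s0a.
have [W WU] : exists W, W *m U = 1%:M by exists (invmx U); rewrite mulVmx.
have [X VX] : exists X, V *m X = 1%:M by exists (invmx V); rewrite mulmxV.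
have Vrow j : V 0 j = c * W 0 0 * a 0 j + c * W 0 1 * a 1 j.
  have : (W *m a) 0 j = s`_0 * V 0 j.
    by rewrite aE !mulmxA WU mul1mx SE mulmx22 !mx22E mul0r addr0.
  rewrite mulmx22 => WaE; transitivity (c * (s`_0 * V 0 j)).
    by rewrite mulrA -cE mul1r.
  by rewrite -WaE; ring.
have HV : rowspan a (V 0 0) (V 0 1) by exists (c * W 0 0), (c * W 0 1).
have dVX : \det V * \det X = 1 by rewrite -det_mulmx VX det1.
have XV : X *m V = 1%:M by apply: mulmx1C.
pose w := to_torus L (tau_pt (V 0 0) (V 0 1) / n%:R).
have wM (k : int) : w *~ k = to_torus L (tau_pt (k * V 0 0) (k * V 0 1) / n%:R).
  rewrite /w -raddfMz; congr to_torus; rewrite -mulrzl /tau_pt !rmorphM /=.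
  by rewrite mulrA; congr (_ / _); ring.
exists w; apply/seteqP; split=> [_ [x [y [h ->]]]|_ [k _ <-]]; last first.
  exists (k * V 0 0), (k * V 0 1); split=> //.
  exact: subgroup_mul (@rowspan_sub a) (rowspan_n0 da) _ _ _ HV.
exists (x * X 0 0 + y * X 1 0) => //; rewrite wM; apply/esym/tau_pt_divn.
pose b := x * X 0 1 + y * X 1 1.
have xE : x - (x * X 0 0 + y * X 1 0) * V 0 0 = b * V 1 0.
  have := congr1 (fun M : 'M_2 => (M 0 0, M 1 0)) XV; rewrite !mulmx22 !mxE /= => -[e1 e2].
  apply/eqP; rewrite subr_eq; apply/eqP.
  transitivity (x * (X 0 0 * V 0 0 + X 0 1 * V 1 0) + y * (X 1 0 * V 0 0 + X 1 1 * V 1 0)).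
    by rewrite e1 e2 mulr0 addr0 mulr1.
  by rewrite /b; ring.
have yE : y - (x * X 0 0 + y * X 1 0) * V 0 1 = b * V 1 1.
  have := congr1 (fun M : 'M_2 => (M 0 1, M 1 1)) XV; rewrite !mulmx22 !mxE /= => -[e1 e2].
  apply/eqP; rewrite subr_eq; apply/eqP.
  transitivity (x * (X 0 0 * V 0 1 + X 0 1 * V 1 1) + y * (X 1 0 * V 0 1 + X 1 1 * V 1 1)).
    by rewrite e1 e2 mulr0 add0r mulr1.
  by rewrite /b; ring.
suff nb : (n %| b)%Z by rewrite xE yE !dvdz_mulr.
(* Up to the factor [\det X], [b] is the determinant of the first row of [V] and [(x, y)]. Both lie
   in the row lattice of [a], so it is a multiple of [\det a = n]. *)
have -> : b = (V 0 0 * y - V 0 1 * x) * \det X.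
  rewrite -[b]mulr1 -dVX mulrA; congr (_ * _).
  have -> : y = b * V 1 1 + (x * X 0 0 + y * X 1 0) * V 0 1 by rewrite -yE subrK.
  have {2}-> : x = b * V 1 0 + (x * X 0 0 + y * X 1 0) * V 0 0 by rewrite -xE subrK.
  by rewrite det22; ring.
rewrite dvdz_mulr //; have [u [v [-> ->]]] := h.
rewrite !Vrow -da det22; apply/dvdzP.
by exists (c * (W 0 0 * v - W 0 1 * u)); ring.
Qed.

(** If [g] divides all entries of [a], the kernel is killed by [n / g]; being cyclic, it has at most
    [n / g] elements, so [g = 1]. *)
Lemma kernel_cyclic a : \det a = n%:Z ->
  cyclic_subgroup_of_order n (kernel_of (rowspan a)) -> primitive_mx a.
Proof.
move=> da [[_ _ cardK] [w KE]]; rewrite /primitive_mx.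
set g := gcdz _ _.
have ga i j : (g %| a i j)%Z := primitive_mx_dvd a i j.
have g_ge0 : 0 <= g by [].
pose b i j := (a i j %/ g)%Z.
have bE i j : a i j = b i j * g by rewrite /b divzK.
pose N := (b 0 0 * b 1 1 - b 0 1 * b 1 0) * g.
have nE : n%:Z = N * g by rewrite -da det22 !bE /N; ring.
have N_gt0 : 0 < N by nia.
pose m := `|N|%N; have mE : m%:Z = N by rewrite gez0_abs // ltW.
have killed x : kernel_of (rowspan a) x -> x *+ m = 0.
  move=> [y [z [[u [v [-> ->]]] ->]]]; rewrite -to_torusMn; apply/torus_eq0.
  have -> : tau_pt (u * a 0 0 + v * a 1 0) (u * a 0 1 + v * a 1 1) / n%:R *+ m =
      tau_pt (u * b 0 0 + v * b 1 0) (u * b 0 1 + v * b 1 1).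
    apply: (mulIf n_neq0); rewrite -mulr_natr mulrAC divfK ?n_neq0 //.
    rewrite -[m%:R]/(m%:Z%:~R) mE -[n%:R]/(n%:Z%:~R) nE !bE /tau_pt.
    by rewrite !(rmorphD, rmorphM) /=; ring.
  exact: tau_lattice_pt.
have Kw : kernel_of (rowspan a) w by rewrite KE; exists 1.
have m_gt0 : (0 < m)%N by rewrite absz_gt0 gt_eqF.
have : (`I_n #<= `I_m)%card.
  rewrite -(card_le_eql cardK) KE.
  have -> : [set w *~ k | k in [set: int]] = (fun k => w *+ k) @` `I_m.
    apply/seteqP; split=> [_ [k _ <-]|_ [k _ <-]]; last by exists k%:Z.
    exists `|(k %% m)%Z|%N.
      by rewrite /= -ltz_nat gez0_abs ?modz_ge0 ?ltz_pmod //; lia.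
    rewrite pmulrn gez0_abs ?modz_ge0 //; last by lia.
    transitivity (w *~ (m%:Z * (k %/ m)%Z + (k %% m)%Z)).
      by rewrite [RHS]mulrzDr mulrzA -pmulrn killed // mul0rz add0r.
    by rewrite [m%:Z * _]mulrC -divz_eq.
  exact: card_image_le.
rewrite card_le_II => n_le.
by apply/eqP; nia.
Qed.

(** The square of the gcd of the entries divides the determinant. *)
Lemma primitive_mx_squarefree a : (forall d : nat, (d ^ 2 %| n)%N -> d = 1%N) ->
  \det a = n%:Z -> primitive_mx a.
Proof.
move=> sqf da; rewrite /primitive_mx; set g := gcdz _ _.
have g2n : (g * g %| n%:Z)%Z 
  
  by rewrite -da det22; apply: rpredB; apply: dvdz_mul; exact: primitive_mx_dvd.
have : (`|g| ^ 2 %| n)%N by move: g2n; rewrite dvdzE abszM mulnn.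
by move=> /sqf g1; apply/eqP; rewrite -[g]gez0_abs // g1.
Qed.

(** * Matching cosets, subgroups and points of the modular curve *)

Section HeckePoints.
Variables (p : nat) (eps : int) (p_prime : prime p) (n_coprime : coprime n p).

Local Notation D := (Delta_ns_det p eps n).
Local Notation E := (ns_pair_of p eps tau).

Lemma hecke_geo_point_kernel a : D a ->
  @hecke_geo_point R p eps n E (kernel_of (rowspan a)) =
  ns_point (ns_pair_of p eps (mobius tau a)).
Proof.
move=> Da; have iso := mobius_isogenous p_prime n_coprime Da.
apply/ns_point_eq/(ns_isogenous_uniq n_gt0 _ iso).
by apply: xgetPex; exists (ns_pair_of p eps (mobius tau a)).
Qed.

Definition coset_rep (c : set 'M[int]_2) : 'M[int]_2 :=
  xget 0 [set a | D a /\ lcoset (Gamma_ns p eps) a = c].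

Lemma coset_repP c : ns_cosets p eps n c ->
  D (coset_rep c) /\ lcoset (Gamma_ns p eps) (coset_rep c) = c.
Proof.
move=> [a Da ac].
by apply: (@xgetPex _ 0 [set a | D a /\ lcoset (Gamma_ns p eps) a = c]); exists a.
Qed.

Definition coset_kernel (c : set 'M[int]_2) : set (torus L) :=
  kernel_of (rowspan (coset_rep c)).

Lemma coset_kernelE a : D a ->
  coset_kernel (lcoset (Gamma_ns p eps) a) = kernel_of (rowspan a).
Proof.
move=> Da; have /coset_repP[_ /lcosetP[g [_ dg] aE]] :
  ns_cosets p eps n (lcoset (Gamma_ns p eps) a) by exists a.
apply: kernel_of_ext => x y.
have := rowspan_SL2 (coset_rep (lcoset (Gamma_ns p eps) a)) x y dg.
by rewrite -aE => h; split; apply h.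
Qed.

(** Equal kernels give [a' = g a], and [Delta_ns_det_div] puts [g] in [Gamma_ns]. Conversely, a
    matrix of a given subgroup is moved into [M_ns] by an element of [SL_2(Z)], with [b] prescribing
    its reduction modulo [p]. *)
Lemma coset_kernel_bij b : M_ns p eps b -> (\det b)%:~R = n%:R :> 'F_p ->
  set_bij (ns_cosets p eps n) [set K | subgroup_of_order n K] coset_kernel.
Proof.
move=> Mb db; split=> [c /coset_repP[[_ dc] _]|c c' cS c'S|K].
- exact: kernel_order.
- have [Dr rE] := coset_repP (set_mem cS); have [Dr' rE'] := coset_repP (set_mem c'S).
  move=> /(kernel_rowspan_inj (proj2 Dr) (proj2 Dr'))[g gE].
  rewrite -rE -rE'; apply/lcosetP; exists g => //.
  exact: Delta_ns_det_div Dr Dr' gE.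
move=> /order_kernel[a da ->].
have [g dg Dga] := exists_Delta_ns_det p_prime n_coprime da Mb db.
exists (lcoset (Gamma_ns p eps) (g *m a)); first by exists (g *m a).
by rewrite coset_kernelE //; apply: kernel_of_ext => x y; apply: rowspan_SL2.
Qed.

(** Any expansion equals the multiplicity-free sum over [ns_cosets] in the free group; a linear
    extension turns this into an equality of sums, reindexed by the bijection with subgroups.
    Keeping [Q] arbitrary allows a restriction to cyclic kernels. *)
Lemma sum_left_coset_expansion (M : lmodType int) (Q : set (torus L) -> M)
    (A : nat -> 'M[int]_2) (s : seq 'M[int]_2) : is_twist p eps n (A n) ->
  left_coset_expansion (Gamma_ns p eps) (hecke_h p eps A (hecke_T p n)) s ->
  {in s, forall a, D a} /\
  \sum_(a <- s) Q (kernel_of (rowspan a)) =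
  \sum_(K \in [set K | subgroup_of_order n K]) Q K.
Proof.
move=> tA; rewrite /left_coset_expansion left_cosets_hecke_T // => sE.
have finS := finite_ns_cosets p_prime eps n_gt0 n_coprime.
have sD : {in s, forall a, D a}.
  move=> a sa; have /(congr1 (coeff (lcoset (Gamma_ns p eps) a))) := sE.
  rewrite coeff_fsum // raddf_sum /=; case: (boolP (_ \in _)) => [/set_mem aS _|_].
    have [a' Da' /lcosetP[g Gg ->]] := aS.
    rewrite -(mulmx1 (g *m a')); apply: Delta_ns_det_mul => //.
    exact: Gamma_ns1.
  under eq_bigr do rewrite coeffU mul1r.
  (* The entry [a] contributes 1 to a sum of nonnegative coefficients, which therefore cannot
     vanish. *)
  rewrite (big_rem a sa) /= eqxx => /eqP; rewrite eq_sym gt_eqF //.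
  by rewrite ltr_wpDr // sumr_ge0.
split=> //; pose F c := Q (coset_kernel c).
transitivity (\sum_(a <- s) F (lcoset (Gamma_ns p eps) a)).
  by apply: eq_big_seq => a /sD Da; rewrite /F coset_kernelE.
transitivity (fglift F (\sum_(a <- s) << lcoset (Gamma_ns p eps) a >>)).
  by rewrite fglift_sum; apply: eq_bigr => a _; rewrite liftU scale1r.
rewrite -sE fsbig_finite // fglift_sum.
under eq_bigr do rewrite liftU scale1r.
have [_ [b [[Mb _ _] db _]]] := tA.
by rewrite -fsbig_finite // (reindex_fsbig _ _ _ _ (coset_kernel_bij Mb db)).
Qed.

End HeckePoints.

End Kernels.

Theorem theorem1p10 (R : realType) (p : nat) (eps : int) (n : nat)
    (A : nat -> 'M[int]_2)
    (p_prime : prime p) (p_odd : odd p)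
    (eps_nonsquare : forall x : 'F_p, x ^+ 2 != eps%:~R)
    (n_gt0 : (0 < n)%N) (n_coprime : coprime n p)
    (A_twist : forall m, coprime m p -> is_twist p eps m (A m)) :
  let T := hecke_h p eps A (hecke_T p n) in
  let expansion := left_coset_expansion (Gamma_ns p eps) T in
  (exists s, expansion s) /\
  forall (tau : upper_half R) (s : seq 'M[int]_2), expansion s ->
  let E := ns_pair_of p eps tau in
  let point a : ns_divisor R p eps :=
    << ns_point (ns_pair_of p eps (mobius tau a)) >> in
  [/\ (forall d : nat, (d ^ 2 %| n)%N -> d = 1%N) ->
        \sum_(a <- s) point a = hecke_geo n E,
      \sum_(a <- s | primitive_mx a) point a = hecke_geo n E &
      \sum_(a <- s) point a = hecke_geo_all n E].
Proof.
move=> T expansion; have tA : is_twist p eps n (A n) by exact: A_twist.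
split.
  have finS := finite_ns_cosets p_prime eps n_gt0 n_coprime.
  exists [seq coset_rep n p eps c | c <- fset_set (ns_cosets p eps n)].
  rewrite /expansion /left_coset_expansion left_cosets_hecke_T //.
  rewrite fsbig_finite // big_map; apply: eq_big_seq => c /(mem_fset_set _ finS) cS.
  by have [_ ->] := coset_repP cS.
move=> tau s sE E point.
pose P (K : set (ns_curve E)) : ns_divisor R p eps := << hecke_geo_point n K >>.
(* Extending by zero to non-cyclic subgroups expresses the cyclic sum as a sum over all subgroups of
   order [n]. *)
pose P' (K : set (ns_curve E)) : ns_divisor R p eps :=
  if K \in [set K | cyclic_subgroup_of_order n K]%classic then P K else 0.
have [sD sum_all] := sum_left_coset_expansion n_gt0 p_prime n_coprime P tA sE.
have [_ sum_cyc] := sum_left_coset_expansion n_gt0 p_prime n_coprime P' tA sE.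
have pointE a : a \in s -> P (kernel_of n (rowspan a)) = point a.
  by move=> /sD Da; rewrite /P hecke_geo_point_kernel.
have sum_prim : \sum_(a <- s | primitive_mx a) point a = hecke_geo n E.
  rewrite big_mkcond /hecke_geo.
  transitivity (\sum_(a <- s) P' (kernel_of n (rowspan a))).
    apply: eq_big_seq => a sa; rewrite /P' pointE //; have [_ da] := sD a sa.
    have -> : primitive_mx a = (kernel_of n (rowspan a) \in
       [set K : set (ns_curve E) | cyclic_subgroup_of_order n K]%classic) => //.
    apply/idP/idP => [prim_a|/set_mem].
      by apply/mem_set; exact: cyclic_kernel.
    exact: kernel_cyclic.
  rewrite sum_cyc /P' -fsbig_mkcondr; apply: eq_fsbigl.
  by apply/seteqP; split=> [K []//|K cK]; split=> //; case: cK.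
split=> // [sqf|].
  rewrite -sum_prim [RHS]big_mkcond; apply: eq_big_seq => a /sD[_ da].
  by rewrite (primitive_mx_squarefree sqf).
by rewrite /hecke_geo_all -sum_all; apply: eq_big_seq => a sa; rewrite pointE.
Qed.
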